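(* Let $0<\delta,\lambda<1$ and let $\Pi$ be a stationary randomized MPE, with state functions $H,Q,A$ as in the context. For every fixed initial state $\alpha_0$, $H(\alpha_t)$ is a bounded submartingale with respect to the filtration $\mathcal F_t=\sigma(\alpha_0,x_0,\alpha_1,\ldots,x_{t-1},\alpha_t)$. There is a bounded random variable $L$ such that $$H(\alpha_t),\ h(\alpha_t),\ A(\alpha_t),\ Q(\alpha_t)\longrightarrow L\quad\text{almost surely and in }L^1.$$ For each fixed integer $k\ge1$, $$\mathbb E_{\alpha_0}\sum_{t=0}^\infty[h(\alpha_t)-U(\alpha_t,x_{t+k})]\le\frac{(1-\lambda)(\mathbb E_{\alpha_0}L-H(\alpha_0))}{\lambda(1-\delta)^2\delta^{k-1}}.$$ In particular, each of these nonnegative loss sequences $(h(\alpha_t)-U(\alpha_t,x_{t+k}))_{t\ge0}$ is summable almost surely.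
   Context: $J=\{1,\ldots,n\}$ and $X$ are nonempty finite sets (pure worldviews and actions) with payoffs $u_j(x)\in\mathbb R$. $\Delta^n=\{\alpha\in\mathbb R^n:\alpha^j\ge0,\ \sum_j\alpha^j=1\}$. $U(\alpha,x)=\sum_j\alpha^ju_j(x)$, $z^*(\alpha)=\arg\max_{x\in X}U(\alpha,x)$, $h(\alpha)=\max_{x\in X}U(\alpha,x)$. A stationary randomized strategy is a Borel probability kernel $\alpha\mapsto\Pi_\alpha$ from $\Delta^n$ to $X\times\Delta^n$, with marginals $s_\alpha$ on $X$ and $\kappa_\alpha$ on $\Delta^n$. From a fixed $\alpha_0$, conditional on $\mathcal F_t$, the pair $(x_t,\alpha_{t+1})$ has law $\Pi_{\alpha_t}$; $\mathbb E_\beta$ is expectation when $\alpha_0=\beta$. Put $$C_\Pi(\beta;\alpha)=\mathbb E_\beta\sum_{k=0}^\infty\delta^k\big[(1-\lambda)U(\alpha_k,x_k)+\lambda U(\alpha,x_k)\big],\qquad S(\alpha)=\int C_\Pi(\beta;\alpha)\,\kappa_\alpha(d\beta).$$ $\Pi$ is a stationary randomized MPE if for every $\alpha\in\Delta^n$: $s_\alpha(z^*(\alpha))=1$ and $S(\alpha)\ge C_\Pi(\gamma;\alpha)$ for every $\gamma\in\Delta^n$. For such $\Pi$ define, with $(Tf)(\alpha)=\int f(\beta)\,\kappa_\alpha(d\beta)$, $$H(\alpha)=(1-\delta)\mathbb E_\alpha\sum_{k=0}^\infty\delta^kh(\alpha_k),\quad Q(\alpha)=(1-\delta)\mathbb E_\alpha\sum_{k=1}^\infty\delta^{k-1}U(\alpha,x_k),$$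 $$A(\alpha)=(1-\delta)S(\alpha)=(1-\lambda)(TH)(\alpha)+\lambda Q(\alpha).$$ Inside these definitions $\alpha$ in $U(\alpha,x_k)$ is the fixed starting state. *)

(* Defs.v *)
From HB Require Import structures.
From mathcomp Require Import all_boot all_order all_algebra.
From mathcomp Require Import all_classical all_reals all_analysis.

Set Implicit Arguments.
Unset Strict Implicit.
Unset Printing Implicit Defensive.

Import Order.TTheory GRing.Theory Num.Theory.
Import numFieldNormedType.Exports.

Local Open Scope classical_set_scope.
Local Open Scope ring_scope.

(* Measurable types are pointed in this library, so a nonempty finite set is a
   finite type with a distinguished element; only nonemptiness matters. *)
#[short(type="pointedFinType")]
HB.structure Definition PointedFinite := {T of Pointed T & Finite T}.

Definition discrete (X : pointedFinType) : Type := X.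

HB.instance Definition _ (X : pointedFinType) :=
  PointedFinite.copy (discrete X) X.
HB.instance Definition _ (X : pointedFinType) :=
  @isMeasurable.Build default_measure_display (discrete X)
    discrete_measurable discrete_measurable0
    discrete_measurableC discrete_measurableU.

(* The probability simplex on the [n.+1] coordinates ['I_n.+1]. *)
Definition simplex (R : realType) (n : nat) : Type :=
  {w : n.+1.-tuple R |
    [forall j, 0 <= tnth w j] && (\sum_j tnth w j == 1)}.

Section simplex_instances.
Variables (R : realType) (n : nat).

HB.instance Definition _ := Choice.on (simplex R n).

Definition vertex0 : n.+1.-tuple R := [tuple (j == ord0)%:R | j < n.+1].

Lemma vertex0_simplex :
  [forall j, 0 <= tnth vertex0 j] && (\sum_j tnth vertex0 j == 1).
Proof.
apply/andP; split; first by apply/forallP => j; rewrite tnth_mktuple ler0n.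
rewrite (bigD1 ord0)//= tnth_mktuple eqxx big1 ?addr0// => j j0.
by rewrite tnth_mktuple (negPf j0).
Qed.

HB.instance Definition _ :=
  isPointed.Build (simplex R n) (exist _ vertex0 vertex0_simplex).

(* The Borel sigma-algebra of the simplex: the trace of the sigma-algebra of
   R^(n+1), which on tuples is the product of the Borel ones. *)
HB.instance Definition _ :=
  Measurable.copy (simplex R n)
    (g_sigma_algebra_preimageType (@sval (n.+1.-tuple R) _ : simplex R n -> _)).

End simplex_instances.

Section conditioning.
Context {d} {Omega : measurableType d} {R : realType}.
Variable P : probability Omega R.
Implicit Types (G : set (set Omega)) (Y Z : Omega -> R).

Definition adapted_to G Z : Prop :=
  forall B : set R, measurable B -> G (Z @^-1` B).

(* [Z] is a version of the conditional expectation of [Y] given [G]. *)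
Definition is_cond_exp G Y Z : Prop :=
  [/\ adapted_to G Z,
      P.-integrable setT (EFin \o Z) &
      forall A, G A ->
        (\int[P]_(w in A) (Y w)%:E = \int[P]_(w in A) (Z w)%:E)%E].

Definition submartingale (F : nat -> set (set Omega)) (M : nat -> Omega -> R) :
    Prop :=
  [/\ forall t, adapted_to (F t) (M t),
      forall t, P.-integrable setT (EFin \o M t) &
      forall s t, (s <= t)%N -> exists Z,
        is_cond_exp (F s) (M t) Z /\ {ae P, forall w, M s w <= Z w}].

Definition cvg_as_and_L1 (M : nat -> Omega -> R) (L : Omega -> R) : Prop :=
  {ae P, forall w, M t w @[t --> \oo] --> L w} /\
  ('E_P[fun w => `|M t w - L w|%R] @[t --> \oo] --> 0)%E.

End conditioning.

Section static.
Variables (R : realType) (n : nat) (X : pointedFinType).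
Variable u : 'I_n.+1 -> X -> R.
Implicit Types alpha : simplex R n.

Definition Uval alpha (x : X) : R := \sum_j tnth (sval alpha) j * u j x.

Definition zstar alpha : set X :=
  [set x | forall y, Uval alpha y <= Uval alpha x].

(* The default value [Uval alpha point] is one of the terms of the maximum. *)
Definition hval alpha : R :=
  \big[Num.max/Uval alpha point]_(x : X) Uval alpha x.

End static.

Section process.
Variables (R : realType) (n : nat) (X : pointedFinType).
Variable Pi : R.-pker simplex R n ~> (discrete X * simplex R n)%type.

Definition s_marginal (alpha : simplex R n) : set (discrete X) -> \bar R :=
  pushforward (Pi alpha) fst.

Definition k_marginal (alpha : simplex R n) : set (simplex R n) -> \bar R :=
  pushforward (Pi alpha) snd.

Section k_marginal_measure.
Variable alpha : simplex R n.

Let k_marginal0 : k_marginal alpha set0 = 0%E.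
Proof. by rewrite /k_marginal /pushforward preimage_set0 measure0. Qed.

Let k_marginal_ge0 B : (0 <= k_marginal alpha B)%E.
Proof. exact: measure_ge0. Qed.

Let k_marginal_sigma_additive : semi_sigma_additive (k_marginal alpha).
Proof.
apply: (@measure_semi_sigma_additive _ _ _ (pushforward (Pi alpha) snd)).
exact: measurable_snd.
Qed.

HB.instance Definition _ := isMeasure.Build _ _ _ (k_marginal alpha)
  k_marginal0 k_marginal_ge0 k_marginal_sigma_additive.

End k_marginal_measure.

Context {d} {Omega : measurableType d}.
Variable P : simplex R n -> probability Omega R.
Variable x : nat -> {mfun Omega >-> discrete X}.
Variable a : nat -> {mfun Omega >-> simplex R n}.

(* sigma(a_0, x_0, a_1, ..., x_(t-1), a_t) *)
Definition history (t : nat) : set (set Omega) :=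
  <<s (\bigcup_(i in [set i | (i < t)%N])
         preimage_set_system setT (x i) measurable) `|`
      (\bigcup_(i in [set i | (i <= t)%N])
         preimage_set_system setT (a i) measurable) >>.

(* [P beta] is the law of the process started at [beta]: conditionally on
   [history t], the pair (x_t, a_(t+1)) has law [Pi (a_t)]. *)
Definition follows : Prop := forall beta,
  {ae P beta, forall w, a 0%N w = beta} /\
  forall (t : nat) (D : set (discrete X * simplex R n)), measurable D ->
    is_cond_exp (P beta) (history t)
      (fun w => \1_D (x t w, a t.+1 w)) (fun w => fine (Pi (a t w) D)).

Variable u : 'I_n.+1 -> X -> R.
Variables delta lambda : R.

Definition Cval (beta alpha : simplex R n) : R :=
  fine 'E_(P beta)[fun w => \big[+%R/0]_(0 <= k <oo)
    (delta ^+ k * ((1 - lambda) * Uval u (a k w) (x k w)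
                   + lambda * Uval u alpha (x k w)))].

Definition Sval (alpha : simplex R n) : R :=
  \int[k_marginal alpha]_beta Cval beta alpha.

Definition stationary_MPE : Prop := forall alpha,
  s_marginal alpha (zstar u alpha) = 1%E /\
  forall gamma, Cval gamma alpha <= Sval alpha.

Definition Hval (alpha : simplex R n) : R :=
  (1 - delta) * fine 'E_(P alpha)[fun w =>
    \big[+%R/0]_(0 <= k <oo) (delta ^+ k * hval u (a k w))].

Definition Qval (alpha : simplex R n) : R :=
  (1 - delta) * fine 'E_(P alpha)[fun w =>
    \big[+%R/0]_(1 <= k <oo) (delta ^+ k.-1 * Uval u alpha (x k w))].

Definition Aval (alpha : simplex R n) : R := (1 - delta) * Sval alpha.

End process.

(* Main.v *)
Require Import Defs.
From HB Require Import structures.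
From mathcomp Require Import all_boot all_order all_algebra.
From mathcomp Require Import all_classical all_reals all_analysis.
From mathcomp Require Import ring lra measurable_realfun.

(* Let [T f alpha] be the mean of [f] at the next state.  Since the action
   played is optimal for the current worldview, [E_beta h(alpha_k) = T^k h beta]
   is also the mean payoff, and every expected discounted sum is a discounted
   sum of iterates of [T]; in particular [H = (1 - delta) h + delta T H].  Comparing
   the equilibrium choice with the deviation [gamma = alpha] gives
     [(1 - lambda) (T H - H) >= lambda (1 - delta) (h - Q) >= 0].
   So [H(alpha_t)] is a bounded submartingale, hence converges, and the drifts
   [(T H - H)(alpha_t)] have summable means, hence tend to 0 almost surely; this
   forces [h], [Q] and [A] to the same limit.  Finally [h - Q] is a discounted
   sum of the nonnegative conditional mean losses, so the drift also dominates
   each of them, and telescoping the drifts bounds the expected total loss. *)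

Set Implicit Arguments.
Unset Strict Implicit.
Unset Printing Implicit Defensive.

Import Order.TTheory GRing.Theory Num.Theory.
Import numFieldNormedType.Exports.

Local Open Scope classical_set_scope.
Local Open Scope ring_scope.

(** * Bounded measurable functions *)

(** A class closed under all the operations used below and integrable for every measure of mass one,
    so that real-valued integrals are linear on it without further side conditions. *)
Definition bmeas d (T : measurableType d) (R : realType) (f : T -> R) : Prop :=
  measurable_fun setT f /\ exists M, forall x, `|f x| <= M.

Section bounded_measurable.
Context {d} {T : measurableType d} {R : realType}.
Implicit Types (f g : T -> R) (A : set T).

Lemma bmeas_cst (c : R) : bmeas (fun _ : T => c).
Proof. by split; [exact: measurable_cst | exists `|c|]. Qed.

Lemma bmeasD f g : bmeas f -> bmeas g -> bmeas (fun x => f x + g x).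
Proof.
move=> [mf [M Mf]] [mg [N Ng]]; split; first exact: measurable_funD.
by exists (M + N) => x; rewrite (le_trans (ler_normD _ _))// lerD.
Qed.

Lemma bmeasM f g : bmeas f -> bmeas g -> bmeas (fun x => f x * g x).
Proof.
move=> [mf [M Mf]] [mg [N Ng]]; split; first exact: measurable_funM.
by exists (M * N) => x; rewrite normrM ler_pM.
Qed.

Lemma bmeasZ (c : R) f : bmeas f -> bmeas (fun x => c * f x).
Proof. by move=> bf; apply: bmeasM => //; exact: bmeas_cst. Qed.

Lemma bmeasN f : bmeas f -> bmeas (fun x => - f x).
Proof.
by move=> /(bmeasZ (-1)); congr bmeas; apply/funext => x; rewrite mulN1r.
Qed.

Lemma bmeasB f g : bmeas f -> bmeas g -> bmeas (fun x => f x - g x).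
Proof. by move=> bf bg; apply: bmeasD => //; exact: bmeasN. Qed.

Lemma bmeas_sum (I : Type) (s : seq I) (h : I -> T -> R) :
  (forall i, bmeas (h i)) -> bmeas (fun x => \sum_(i <- s) h i x).
Proof.
move=> bh; elim: s => [|i s ih].
  by under eq_fun do rewrite big_nil; exact: bmeas_cst.
by under eq_fun do rewrite big_cons; exact: bmeasD.
Qed.

Lemma bmeas_max f g : bmeas f -> bmeas g -> bmeas (fun x => Num.max (f x) (g x)).
Proof.
move=> [mf [M Mf]] [mg [N Ng]]; split; first exact: measurable_maxr.
exists (Num.max M N) => x; rewrite le_max.
by case: (leP (f x)) => _; rewrite ?Mf ?Ng ?orbT.
Qed.

Lemma bmeas_indic A : measurable A -> bmeas (\1_A : T -> R).
Proof.
move=> mA; split; first exact: measurable_indic.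
by exists 1 => x; rewrite indicE; case: (x \in A); rewrite ?normr1 ?normr0.
Qed.

Lemma bmeas_comp d' (T' : measurableType d') (g : T' -> T) f :
  bmeas f -> measurable_fun setT g -> bmeas (fun x => f (g x)).
Proof.
move=> [mf [M Mf]] mg; split; first exact: measurableT_comp mf mg.
by exists M.
Qed.

Lemma bmeas_bounded f A : bmeas f -> [bounded f x | x in A].
Proof.
move=> [_ [M Mf]]; exists M; split; first exact: num_real.
by move=> N /ltW MN x _; rewrite /= (le_trans (Mf x)).
Qed.

Section integral.
Variable mu : {measure set T -> \bar R}.
Hypothesis mu1 : mu setT = 1%E.

(** Mass one is assumed as an equation so that these facts serve both the laws [P beta] and the
    kernel measures [Pi alpha]. *)
Lemma bmeas_integrable A f : measurable A -> bmeas f ->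
  mu.-integrable A (EFin \o f).
Proof.
move=> mA bf; apply: measurable_bounded_integrable => //.
- have : (mu A <= mu setT)%E by apply: le_measure; rewrite ?inE.
  by move=> /le_lt_trans -> //; rewrite mu1 ltry.
- by case: bf => mf _; exact: measurable_funTS.
- exact: bmeas_bounded.
Qed.

Lemma bmeas_RintegralD A f g : measurable A -> bmeas f -> bmeas g ->
  \int[mu]_(x in A) (f x + g x) =
  \int[mu]_(x in A) f x + \int[mu]_(x in A) g x.
Proof. by move=> *; rewrite RintegralD//; exact: bmeas_integrable. Qed.

Lemma bmeas_RintegralB A f g : measurable A -> bmeas f -> bmeas g ->
  \int[mu]_(x in A) (f x - g x) =
  \int[mu]_(x in A) f x - \int[mu]_(x in A) g x.
Proof. by move=> *; rewrite RintegralB//; exact: bmeas_integrable. Qed.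

Lemma bmeas_RintegralZ A (c : R) f : measurable A -> bmeas f ->
  \int[mu]_(x in A) (c * f x) = c * \int[mu]_(x in A) f x.
Proof. by move=> *; rewrite RintegralZl//; exact: bmeas_integrable. Qed.

Lemma bmeas_Rintegral_sum A (I : Type) (s : seq I) (h : I -> T -> R) :
  measurable A -> (forall i, bmeas (h i)) ->
  \int[mu]_(x in A) (\sum_(i <- s) h i x) =
  \sum_(i <- s) \int[mu]_(x in A) h i x.
Proof.
move=> mA bh; elim: s => [|i s ih].
  under eq_Rintegral do rewrite big_nil.
  by rewrite big_nil Rintegral_cst// mul0r.
under eq_Rintegral do rewrite big_cons.
by rewrite big_cons bmeas_RintegralD ?ih//; exact: bmeas_sum.
Qed.

Lemma bmeas_le_Rintegral A f g : measurable A -> bmeas f -> bmeas g ->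
  (forall x, f x <= g x) -> \int[mu]_(x in A) f x <= \int[mu]_(x in A) g x.
Proof. by move=> *; apply: le_Rintegral => //; exact: bmeas_integrable. Qed.

Lemma bmeas_RintegralE A f : measurable A -> bmeas f ->
  (\int[mu]_(x in A) (f x)%:E)%E = (\int[mu]_(x in A) f x)%:E.
Proof.
move=> mA bf; rewrite /Rintegral fineK//.
by apply: integrable_fin_num => //; exact: bmeas_integrable.
Qed.

Lemma Rintegral_cst1 (c : R) : \int[mu]_x c = c.
Proof. by rewrite Rintegral_cst// [X in fine X]mu1 mulr1. Qed.

Lemma Rintegral_norm_le A f (M : R) : measurable A -> bmeas f ->
  (forall x, `|f x| <= M) -> `|\int[mu]_(x in A) f x| <= M.
Proof.
move=> mA bf fM; have M0 : 0 <= M by exact: le_trans (normr_ge0 _) (fM point).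
rewrite (le_trans (le_normr_Rintegral _ _))//; first exact: bmeas_integrable.
(* The integral over [A] becomes one over the whole space, of [|f|] cut off to 0 outside [A], and is
   compared there with the constant [M]. *)
rewrite Rintegral_mkcond -[leRHS]Rintegral_cst1.
have bn : bmeas (fun x => `|f x|).
  case: bf => mf _; split; first exact: measurableT_comp.
  by exists M => x; rewrite normr_id.
apply: bmeas_le_Rintegral => //; last 2 first.
- exact: bmeas_cst.
- by move=> x; rewrite patchE; case: ifPn.
split; first by apply/(measurable_restrictT _ _).1 => //; case: bn => m _;
  exact: measurable_funTS.
by exists M => x; rewrite patchE; case: ifPn => _; rewrite ?normr_id ?normr0.
Qed.

(** Dominated convergence, with the constant [M] as integrable bound. *)
Lemma Rintegral_cvg (f_ : nat -> T -> R) f (M : R) :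
  (forall n, measurable_fun setT (f_ n)) -> measurable_fun setT f ->
  (forall n x, `|f_ n x| <= M) ->
  {ae mu, forall x, f_ n x @[n --> \oo] --> f x} ->
  \int[mu]_x f_ n x @[n --> \oo] --> \int[mu]_x f x.
Proof.
move=> mf_ mf fM cf.
have [|||||/integrable_fin_num intf _ cvgf] := @dominated_convergence _ T R mu
  setT measurableT (fun n => EFin \o f_ n) (EFin \o f) (cst M%:E).
- by move=> n; exact/measurable_EFinP.
- exact/measurable_EFinP.
- apply: filterS cf => x cx _; exact/cvg_EFin/cx/nearW.
- by apply: (bmeas_integrable (f := cst M)) => //; exact: bmeas_cst.
- by apply: aeW => x n _; rewrite /= lee_fin.
apply: fine_cvg; rewrite fineK//; exact: intf.
Qed.

End integral.

(* Every [f] with values in [0, 1] is the midpoint of the indicator of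
   [1/2 <= f] and of the function [2 f - 1_(1/2 <= f)], again with values in
   [0, 1]; iterating this halving kills a linear functional that vanishes on
   indicators and is bounded on functions with values in [0, 1]. *)
Lemma bmeas_functional_eq0 (e : (T -> R) -> R) (C : R) :
  (forall f g, bmeas f -> bmeas g -> e (fun x => f x + g x) = e f + e g) ->
  (forall c f, bmeas f -> e (fun x => c * f x) = c * e f) ->
  (forall A, measurable A -> e \1_A = 0) ->
  (forall f, bmeas f -> (forall x, 0 <= f x <= 1) -> `|e f| <= C) ->
  forall f, bmeas f -> e f = 0.
Proof.
move=> eD eZ e1 eC.
have C0 : 0 <= C.
  apply: le_trans (eC (cst 0) _ _) => //; first exact: bmeas_cst.
  by move=> x /=; rewrite lexx ler01.
have step n : forall f, bmeas f -> (forall x, 0 <= f x <= 1) ->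
    `|e f| <= C * 2^-1 ^+ n.
  elim: n => [|n ih] f bf f01; first by rewrite expr0 mulr1 eC.
  have mA : measurable [set x | 2^-1 <= f x].
    rewrite -[X in measurable X]setTI -[X in _ `&` X]/(f @^-1` [set r | 2^-1 <= r]).
    by apply: bf.1 => //; rewrite -set_itvcy; exact: measurable_itv.
  set A := [set x | _ <= _] in mA.
  have b1 : bmeas (\1_A : T -> R) by exact: bmeas_indic.
  pose g x := 2 * f x - \1_A x.
  have bg : bmeas g by apply: bmeasB => //; exact: bmeasZ.
  have -> : f = fun x => 2^-1 * \1_A x + 2^-1 * g x.
    by apply/funext => x; rewrite /g; field.
  rewrite eD ?eZ ?e1//; [|exact: bmeasZ..].
  rewrite mulr0 add0r normrM ger0_norm// exprS mulrCA ler_pM//.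
  apply: ih => // x; rewrite /g indicE.
  have := f01 x; case: (boolP (x \in A)); rewrite ?inE ?notin_setE /A/=; lra.
have e01 f : bmeas f -> (forall x, 0 <= f x <= 1) -> e f = 0.
  move=> bf f01; apply/eqP; rewrite -normr_eq0 eq_le normr_ge0 andbT.
  have : C * 2^-1 ^+ n @[n --> \oo] --> C * (0 : R).
    by apply: cvgMr; apply: cvg_expr; rewrite ger0_norm// invf_lt1// ltr1n.
  rewrite mulr0; move/cvg_lim => <-//; apply: limr_ge.
    apply: is_cvgMr; apply/cvg_ex; exists 0; apply: cvg_expr.
    by rewrite ger0_norm// invf_lt1// ltr1n.
  by apply: nearW => n; exact: step.
move=> f bf; have [M fM] := bf.2.
have M0 : 0 <= M by exact: le_trans (normr_ge0 _) (fM point).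
(* A general [f] is an affine image of a function with values in [0, 1]; its constant term is a
   multiple of the indicator of the whole space, where [e] vanishes too. Using [M + 1] keeps the
   divisor positive. *)
pose g x := (f x + (M + 1)) / (2 * (M + 1)).
have bg : bmeas g.
  rewrite /g; under eq_fun do rewrite mulrC.
  by apply: bmeasZ; apply: bmeasD => //; exact: bmeas_cst.
have -> : f = fun x => 2 * (M + 1) * g x + - (M + 1) * \1_setT x.
  apply/funext => x; rewrite /g indicE in_setT mulr1; field; lra.
rewrite eD ?eZ ?e1 ?e01//; [ring| |exact: bmeas_indic|exact: bmeasZ|].
- move=> x; rewrite /g; have := fM x; rewrite ler_norml => /andP[h1 h2].
  have M1 : 0 < 2 * (M + 1) by lra.
  by rewrite divr_ge0 ?ler_pdivrMr//; lra.
- by apply: bmeasZ; exact: bmeas_indic.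
Qed.

End bounded_measurable.

(** * Almost sure convergence of bounded submartingales *)

Section summation.
Context {d} {T : measurableType d} {R : realType} (P : probability T R).

(** Monotone convergence exchanges sum and integral in the extended reals. *)
Lemma integral_series_le (Y : nat -> T -> R) (K : R) :
  (forall t, bmeas (Y t)) -> (forall t w, 0 <= Y t w) ->
  (forall N, \sum_(0 <= t < N) \int[P]_w Y t w <= K) ->
  (\int[P]_w (\sum_(0 <= t <oo) (Y t w)%:E) <= K%:E)%E.
Proof.
move=> bY Y0 YK.
have mY t : measurable_fun setT (fun w => (Y t w)%:E).
  by apply/measurable_EFinP; case: (bY t).
rewrite integral_nneseries//; last by move=> t w _; rewrite lee_fin.
apply: lime_le.
  by apply: is_cvg_nneseries => t _ _; apply: integral_ge0 => w _; rewrite lee_fin.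
apply: nearW => N.
rewrite (eq_bigr (fun t => (\int[P]_w Y t w)%:E)); last first.
  by move=> t _; apply: bmeas_RintegralE => //; exact: probability_setT.
by rewrite sumEFin lee_fin.
Qed.

(** An integrable sum is finite almost everywhere, and it bounds the nondecreasing partial sums.
    This is applied to upcrossings, to drifts and to losses. *)
Lemma ae_cvg_series (Y : nat -> T -> R) (K : R) :
  (forall t, bmeas (Y t)) -> (forall t w, 0 <= Y t w) ->
  (forall N, \sum_(0 <= t < N) \int[P]_w Y t w <= K) ->
  {ae P, forall w, cvgn (series (fun t => Y t w))}.
Proof.
move=> bY Y0 YK; have IK := integral_series_le bY Y0 YK.
have mY t : measurable_fun setT (fun w => (Y t w)%:E).
  by apply/measurable_EFinP; case: (bY t).
have S0 w : (0 <= \sum_(0 <= t <oo) (Y t w)%:E)%E.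
  by apply: nneseries_ge0 => t _ _; rewrite lee_fin.
have /integrable_ae : P.-integrable setT (fun w => \sum_(0 <= t <oo) (Y t w)%:E)%E.
  apply/integrableP; split.
    by apply: (@ge0_emeasurable_sum _ _ _ setT (fun t w => (Y t w)%:E) predT) => //
      t w _ _; rewrite lee_fin.
  under eq_integral do rewrite gee0_abs//.
  by rewrite (le_lt_trans IK) ?ltry.
move=> /(_ measurableT); apply: filterS => w /(_ I) finw.
apply: nondecreasing_is_cvgn.
  by apply: nondecreasing_series => t _ _; exact: Y0.
exists (fine (\sum_(0 <= t <oo) (Y t w)%:E)%E) => _ [N _ <-].
rewrite -lee_fin fineK// /series/= -sumEFin.
by apply: nneseries_lim_ge => t _ _; rewrite lee_fin.
Qed.

Lemma cvg_as_and_L1_bounded (M : nat -> T -> R) (L : T -> R) (K : R) :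
  (forall t, measurable_fun setT (M t)) -> measurable_fun setT L ->
  (forall t w, `|M t w| <= K) -> (forall w, `|L w| <= K) ->
  {ae P, forall w, M t w @[t --> \oo] --> L w} -> cvg_as_and_L1 P M L.
Proof.
move=> mM mL MK LK cM; split => //.
have bD t : bmeas (fun w => `|M t w - L w|).
  split; first by apply: measurableT_comp => //; exact: measurable_funB.
  by exists (K + K) => w; rewrite normr_id (le_trans (ler_normB _ _))// lerD.
have -> : (fun t => 'E_P[(fun w => `|M t w - L w|)%R]%E) =
    fun t => (\int[P]_w `|M t w - L w|)%:E.
  apply/funext => t.
  rewrite unlock; apply: bmeas_RintegralE => //; exact: probability_setT.
have : \int[P]_w `|M t w - L w| @[t --> \oo] --> \int[P]_w (0 : R).
  apply: (@Rintegral_cvg _ _ _ _ _ _ _ (K + K)) => //=.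
  - exact: probability_setT.
  - by move=> t; case: (bD t).
  - by move=> t w; rewrite normr_id (le_trans (ler_normB _ _))// lerD.
  - apply: filterS cM => w cw.
    rewrite -(normr0 R) -(subrr (L w)); apply: cvg_norm; apply: cvgB => //.
    exact: cvg_cst.
rewrite (Rintegral_cst1 (probability_setT P)) => h.
by apply/fine_cvgP; split; [exact: nearW | exact: h].
Qed.

End summation.

(** * Upcrossings of a single path *)

Section upcrossing.
Context {R : realType}.
Implicit Types (a b : R) (m : nat -> R).

(* The trading strategy of Doob's upcrossing argument. *)
Fixpoint holding a b m (t : nat) : bool :=
  if t is t'.+1 then if holding a b m t' then m t <= b else m t < a
  else m 0%N < a.

(** A unit bought below [a] and sold above [b] earns at least [b - a]. A position still open at time
    [N] is carried at [m N - a], which makes the induction go through. *)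
Lemma upcrossing_gain a b m N : a < b ->
  (b - a) * (\sum_(0 <= t < N) (holding a b m t && ~~ holding a b m t.+1)%:R)
    + (if holding a b m N then m N - a else 0)
  <= \sum_(0 <= t < N) (holding a b m t)%:R * (m t.+1 - m t).
Proof.
move=> ab; elim: N => [|N].
  by rewrite !big_nil mulr0 add0r /=; case: ifP => [/ltW|]; rewrite ?subr_le0.
rewrite !big_nat_recr//=; case: (holding a b m N) => /=; case: ifPn => /=; lra.
Qed.

Lemma cvg_series_nat_eventually0 (p : nat -> bool) :
  cvgn (series (fun t => (p t)%:R : R)) -> \forall t \near \oo, p t = false.
Proof.
move=> /cvg_series_cvg_0/cvgrPdist_lt/(_ 1 ltr01); apply: filterS => t.
by case: (p t) => //; rewrite sub0r normrN normr1 ltxx.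
Qed.

(** After the last sale, either some unit is held, hence held for ever, and the path stays at most
    [b]; or nothing is ever bought again, and the path stays at least [a]. *)
Lemma no_upcrossing a b m :
  (\forall t \near \oo, holding a b m t && ~~ holding a b m t.+1 = false) ->
  (\forall t \near \oo, m t <= b) \/ (\forall t \near \oo, a <= m t).
Proof.
move=> [N _ Nh].
have [[t0 Nt0 ht0]|nh] := pselect (exists2 t, (N <= t)%N & holding a b m t).
  left; exists t0.+1 => // t /= tt0.
  have ht k : holding a b m (t0 + k).
    elim: k => [|k ih]; first by rewrite addn0.
    rewrite addnS; have := Nh (t0 + k)%N (leq_trans Nt0 (leq_addr _ _)).
    by rewrite ih /= => /negbFE.
  rewrite -(subnKC tt0) addSn.
  by have /= := ht (t - t0.+1).+1; rewrite addnS /= ht.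
right; exists N.+1 => // -[//|t] /= Nt.
have := introN idP (fun h => nh (ex_intro2 _ _ t.+1 (leqW Nt) h)).
have := introN idP (fun h => nh (ex_intro2 _ _ t Nt h)).
by move=> /= /negbTE -> ; rewrite -leNgt.
Qed.

(** The limit is the supremum of the eventual lower bounds. For rationals [q < r] strictly between
    it and that supremum plus [e], [q] is no eventual lower bound, so [r] is an eventual upper
    bound. *)
Lemma cvg_of_no_rat_upcrossing m (K : R) : (forall t, `|m t| <= K) ->
  (forall q r : rat, q < r -> (\forall t \near \oo, m t <= ratr r) \/
                              (\forall t \near \oo, ratr q <= m t)) ->
  cvgn m.
Proof.
move=> mK h; pose E := [set c : R | \forall t \near \oo, c <= m t].
have E0 : E (- K) by apply: nearW => t; have := mK t; rewrite ler_norml => /andP[].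
have Eub : ubound E K.
  move=> c [N _ /(_ N (leqnn N))] /= cN; rewrite (le_trans cN)//.
  by rewrite (le_trans (ler_norm _)).
have Esup : has_sup E by split; [exists (- K) | exists K].
apply/cvg_ex; exists (sup E); apply/cvgrPdist_le => /= e e0.
have lo : \forall t \near \oo, sup E - e <= m t.
  have [c Ec /ltW cE] := sup_adherent e0 Esup.
  by apply: filterS Ec => t; exact: le_trans.
have up : \forall t \near \oo, m t <= sup E + e.
  have [r] := @rat_in_itvoo R (sup E) (sup E + e) ltac:(lra).
  rewrite in_itv/= => /andP[r1 r2].
  have [q] := @rat_in_itvoo R (sup E) (ratr r) r1.
  rewrite in_itv/= => /andP[q1 q2]; rewrite ltr_rat in q2.
  have [|Eq] := h _ _ q2.
    by apply: filterS => t /le_trans -> //; exact: ltW.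
  by have := ub_le_sup Esup.2 Eq; rewrite leNgt q1.
by near=> t; rewrite ler_distlC; apply/andP; split; near: t.
Unshelve. all: by end_near. Qed.

End upcrossing.

(** * Doob's convergence theorem for bounded submartingales *)

Section submartingale_convergence.
Context {d} {Omega : measurableType d} {R : realType}.
Variable P : probability Omega R.
Variables (F : nat -> set (set Omega)) (M : nat -> Omega -> R) (K : R).
Hypothesis Fsigma : forall t, sigma_algebra setT (F t).
Hypothesis Fmeas : forall t, F t `<=` measurable.
Hypothesis Fincr : forall t, F t `<=` F t.+1.
Hypothesis FM : forall t, adapted_to (F t) (M t).
Hypothesis MK : forall t w, `|M t w| <= K.
Hypothesis Mle : forall t A, F t A ->
  \int[P]_(w in A) M t w <= \int[P]_(w in A) M t.+1 w.

Let P1 : P setT = 1%E. Proof. exact: probability_setT. Qed.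

Let FC t A : F t A -> F t (~` A).
Proof. by move=> FA; rewrite -setTD; case: (Fsigma t) => _ h _; exact: h. Qed.

Let FU t A B : F t A -> F t B -> F t (A `|` B).
Proof.
move=> FA FB; have [F0 _ Fb] := Fsigma t.
rewrite -bigcup2E; apply: Fb => -[|[|k]] //=.
Qed.

Let FI t A B : F t A -> F t B -> F t (A `&` B).
Proof.
by move=> FA FB; rewrite -[_ `&` _]setCK setCI; apply/FC/FU; exact: FC.
Qed.

Let bM t : bmeas (M t).
Proof.
split; last by exists K.
by move=> _ B mB; rewrite setTI; apply: (Fmeas (t := t)); exact: FM.
Qed.

Let hold a b t := [set w | holding a b (fun k => M k w) t].

(** The decision at time [t] depends on the path up to [t] only, so the strategy is known before the
    increment it is applied to. *)
Let F_hold a b t : F t (hold a b t).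
Proof.
elim: t => [|t ih].
  rewrite (_ : hold _ _ _ = M 0%N @^-1` `]-oo, a[); first exact: FM.
  by apply/seteqP; split => w; rewrite /hold/= in_itv.
rewrite (_ : hold _ _ _ = (hold a b t `&` (M t.+1 @^-1` `]-oo, b])) `|`
    (~` hold a b t `&` (M t.+1 @^-1` `]-oo, a[))).
  have ih1 := Fincr ih; apply: FU; apply: FI => //.
  - exact: FM.
  - exact: FC.
  - exact: FM.
apply/seteqP; split => w; rewrite /hold/= !in_itv/=.
  by case: ifPn => h1 h2; [left | right].
by case => -[h]; [rewrite h | move: h => /negP/negbTE ->].
Qed.

Let indic_hold a b t w : \1_(hold a b t `&` ~` hold a b t.+1) w =
  (holding a b (M ^~ w) t && ~~ holding a b (M ^~ w) t.+1)%:R :> R.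
Proof.
rewrite indicE in_setI in_setC; congr (nat_of_bool (_ && ~~ _))%:R;
  by apply/idP/idP; rewrite inE.
Qed.

(** Doob's upcrossing inequality. In the constant, [K + |a|] absorbs a loss on the position left
    open at time [N], and [K + K] bounds the mean of [M N - M 0]. *)
Let upcrossing_mean a b : a < b -> forall N,
  \sum_(0 <= t < N) \int[P]_w
     (\1_(hold a b t `&` ~` hold a b t.+1) w : R) <= (3 * K + `|a|) / (b - a).
Proof.
move=> ab N; rewrite ler_pdivlMr ?subr_gt0// mulrC.
have mh t : measurable (hold a b t) by exact: Fmeas (F_hold _ _ _).
have mu t : measurable (hold a b t `&` ~` hold a b t.+1).
  by apply: measurableI => //; exact: measurableC.
have bu t : bmeas (\1_(hold a b t `&` ~` hold a b t.+1) : Omega -> R).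
  exact: bmeas_indic.
have bh t : bmeas (\1_(hold a b t) : Omega -> R) by exact: bmeas_indic.
have bd t : bmeas (fun w => M t.+1 w - M t w) by exact: bmeasB.
have bhd t : bmeas (fun w => \1_(hold a b t) w * (M t.+1 w - M t w)).
  exact: bmeasM.
rewrite -bmeas_Rintegral_sum// -bmeas_RintegralZ//; last exact: bmeas_sum.
have -> : 3 * K + `|a| = \int[P]_w (K + `|a|) + (K + K).
  by rewrite Rintegral_cst1//; ring.
apply: (@le_trans _ _ (\int[P]_w (K + `|a| +
    \sum_(0 <= t < N) \1_(hold a b t) w * (M t.+1 w - M t w)))).
  apply: bmeas_le_Rintegral => //.
  - by apply: bmeasZ; exact: bmeas_sum.
  - by apply: bmeasD; [exact: bmeas_cst | exact: bmeas_sum].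
  move=> w; have := upcrossing_gain (fun k => M k w) N ab.
  rewrite (eq_bigr (fun t => \1_(hold a b t `&` ~` hold a b t.+1) w)); last first.
    by move=> t _; rewrite indic_hold.
  rewrite [X in _ <= X -> _](eq_bigr (fun t =>
      \1_(hold a b t) w * (M t.+1 w - M t w))); last first.
    move=> t _; rewrite indicE; congr (_ %:R * _); congr nat_of_bool.
    by apply/idP/idP; rewrite inE.
  have := ler_norm a; have := normr_ge0 a; have := MK N w.
  rewrite ler_norml => /andP[h1 h2].
  case: ifP => _; lra.
rewrite bmeas_RintegralD//; [|exact: bmeas_cst|exact: bmeas_sum].
rewrite lerD2l bmeas_Rintegral_sum//.
(* Holding at all times does at least as well on average: the difference is the mean increment over
   the complement of the holding event, nonnegative by [Mle]. The sum then telescopes. *)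
apply: (@le_trans _ _ (\sum_(0 <= t < N) (\int[P]_w M t.+1 w - \int[P]_w M t w))).
  apply: ler_sum => t _; rewrite -bmeas_RintegralB//.
  rewrite -subr_ge0 -bmeas_RintegralB//.
  have -> : \int[P]_w (M t.+1 w - M t w - \1_(hold a b t) w * (M t.+1 w - M t w)) =
      \int[P]_(w in ~` hold a b t) (M t.+1 w - M t w).
    rewrite [RHS]Rintegral_mkcond; apply: eq_Rintegral => w _.
    rewrite patchE in_setC indicE; case: (w \in hold a b t).
      by rewrite mul1r subrr.
    by rewrite mul0r subr0.
  rewrite bmeas_RintegralB//; last exact: measurableC.
  by rewrite subr_ge0; apply: Mle; exact: FC.
rewrite telescope_sumr// lerD//.
  by rewrite (le_trans (ler_norm _))//; exact: Rintegral_norm_le.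
by rewrite (le_trans (ler_norm _))// normrN; exact: Rintegral_norm_le.
Qed.

Lemma submartingale_cvg : {ae P, forall w, cvgn (fun t => M t w)}.
Proof.
have nocross (q r : rat) : q < r -> {ae P, forall w,
    (\forall t \near \oo, M t w <= ratr r) \/ (\forall t \near \oo, ratr q <= M t w)}.
  move=> qr; have qr' : (ratr q : R) < ratr r by rewrite ltr_rat.
  have mh t : measurable (hold (ratr q) (ratr r) t) by exact: Fmeas (F_hold _ _ _).
  have bu t : bmeas (\1_(hold (ratr q) (ratr r) t `&`
      ~` hold (ratr q) (ratr r) t.+1) : Omega -> R).
    by apply: bmeas_indic; apply: measurableI => //; exact: measurableC.
  apply: filterS (ae_cvg_series bu _ (upcrossing_mean qr')) => [w cw|t w]; last first.
    by rewrite indicE; case: (w \in _).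
  apply: no_upcrossing; apply: (@cvg_series_nat_eventually0 R).
  by under eq_fun do rewrite -indic_hold.
(* One null set serves all rational pairs, enumerated by their codes. A code of no pair defaults to
   [(0, 0)], where the premise [q < r] fails. *)
have all : {ae P, forall w, forall n : nat,
    let: (q, r) := odflt (0, 0) (unpickle n : option (rat * rat)) in
    q < r -> (\forall t \near \oo, M t w <= ratr r) \/
             (\forall t \near \oo, ratr q <= M t w)}.
  apply: ae_foralln => n; case: (odflt _ _) => q r.
  have [qr|qr] := boolP (q < r); last exact: aeW.
  by apply: filterS (nocross _ _ qr) => w.
apply: filterS all => w all; apply: (@cvg_of_no_rat_upcrossing _ _ K) => // q r qr.
by have := all (pickle (q, r)); rewrite pickleK; exact.
Qed.

End submartingale_convergence.

(** * Discounted sums *)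

Section discounting.
Context {R : realType}.
Variable delta : R.
Hypothesis delta01 : 0 < delta < 1.
Implicit Types (v w : nat -> R) (c M : R).

(** The factor [1 - delta] makes this a weighted average of [v]: the weights sum to 1. *)
Definition discounted v : R := (1 - delta) * limn (series (fun k => delta ^+ k * v k)).

Let d0 : 0 < delta. Proof. by case/andP: delta01. Qed.
Let d1 : delta < 1. Proof. by case/andP: delta01. Qed.
Let d1' : 0 < 1 - delta. Proof. by rewrite subr_gt0. Qed.

Let dk k : 0 < delta ^+ k. Proof. exact: exprn_gt0. Qed.

Let cvg_geom c : series (fun k => delta ^+ k * c) @ \oo --> c / (1 - delta).
Proof.
rewrite (_ : (fun k => _) = geometric c delta).
  by apply: cvg_geometric_series; rewrite ger0_norm ?ltW.
by apply/funext => k; rewrite /geometric/= mulrC.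
Qed.

(** Uniform in [n], this is the dominating constant for exchanging discounted sums with
    integrals. *)
Lemma discounted_norm_le v M n : (forall k, `|v k| <= M) ->
  `|series (fun k => delta ^+ k * v k) n| <= M / (1 - delta).
Proof.
move=> vM; have M0 : 0 <= M by exact: le_trans (vM 0%N).
apply: (@le_trans _ _ (series (fun k => delta ^+ k * M) n)).
  rewrite /series/= (le_trans (ler_norm_sum _ _ _))//; apply: ler_sum => k _.
  by rewrite normrM (ger0_norm (ltW (dk k))) ler_pM2l.
have <- : limn (series (fun k => delta ^+ k * M)) = M / (1 - delta).
  exact/cvg_lim/cvg_geom.
apply: nondecreasing_cvgn_le; last by apply/cvg_ex; eexists; exact: cvg_geom.
by apply: nondecreasing_series => k _ _; rewrite mulr_ge0// ltW.
Qed.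

Lemma is_cvg_discounted v M : (forall k, `|v k| <= M) ->
  cvgn (series (fun k => delta ^+ k * v k)).
Proof.
move=> vM; have M0 : 0 <= M by exact: le_trans (vM 0%N).
apply: normed_cvg; apply: (@series_le_cvg _ _ (fun k => delta ^+ k * M)) => [k|k|k|].
- exact: normr_ge0.
- by rewrite mulr_ge0// ltW.
- by rewrite /= normrM (ger0_norm (ltW (dk k))) ler_pM2l.
- by apply/cvg_ex; eexists; exact: cvg_geom.
Qed.

Lemma discounted_cst c : discounted (fun=> c) = c.
Proof.
rewrite /discounted (_ : limn _ = c / (1 - delta)); last exact/cvg_lim/cvg_geom.
by rewrite mulrC divfK// gt_eqF.
Qed.

Lemma discounted_lin c1 c2 v w M N : (forall k, `|v k| <= M) ->
  (forall k, `|w k| <= N) ->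
  discounted (fun k => c1 * v k + c2 * w k) = c1 * discounted v + c2 * discounted w.
Proof.
move=> vM wN; have cv := is_cvg_discounted vM; have cw := is_cvg_discounted wN.
rewrite /discounted; have -> : series (fun k => delta ^+ k * (c1 * v k + c2 * w k)) =
    fun n => c1 * series (fun k => delta ^+ k * v k) n +
             c2 * series (fun k => delta ^+ k * w k) n.
  apply/funext => n; rewrite /series/= !big_distrr -big_split/=.
  by apply: eq_bigr => k _; ring.
rewrite (_ : limn _ = c1 * limn (series (fun k => delta ^+ k * v k)) +
             c2 * limn (series (fun k => delta ^+ k * w k))); first ring.
by apply/cvg_lim => //; apply: cvgD; apply: cvgMr.
Qed.

Lemma discountedS v M : (forall k, `|v k| <= M) ->
  discounted v = (1 - delta) * v 0%N + delta * discounted (fun k => v k.+1).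
Proof.
move=> vM; have cv := is_cvg_discounted (fun k => vM k.+1).
rewrite /discounted (_ : limn (series (fun k => delta ^+ k * v k)) =
  v 0%N + delta * limn (series (fun k => delta ^+ k * v k.+1))); first ring.
apply/cvg_lim => //; rewrite -(cvg_shiftS (series _)).
rewrite (_ : (fun n => _) = fun n => v 0%N +
    delta * series (fun k => delta ^+ k * v k.+1) n).
  by apply: cvgD; [exact: cvg_cst | exact: cvgMr].
apply/funext => n; rewrite /series/= big_nat_recl// expr0 mul1r big_distrr/=.
by congr (_ + _); apply: eq_bigr => k _; rewrite exprS mulrA.
Qed.

(** Since the weights sum to 1, the right side is the discounted average of the nonnegative gaps
    [c - v k]; only the term of index [j] is kept. *)
Lemma discounted_gap c v M j : (forall k, `|v k| <= M) -> (forall k, v k <= c) ->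
  (1 - delta) * delta ^+ j * (c - v j) <= c - discounted v.
Proof.
move=> vM vc; have cM (k : nat) : `|(fun=> c) k| <= `|c| by [].
have -> : c - discounted v = discounted (fun k => 1 * c + -1 * v k).
  by rewrite (discounted_lin _ _ cM vM) discounted_cst; ring.
rewrite /discounted -mulrA ler_pM2l//.
have pos k : 0 <= delta ^+ k * (1 * c + -1 * v k).
  by rewrite mulr_ge0 ?(ltW (dk k))// mul1r mulN1r subr_ge0.
apply: (@le_trans _ _ (series (fun k => delta ^+ k * (1 * c + -1 * v k)) j.+1)).
  rewrite /series/= big_nat_recr//=.
  rewrite [in leLHS](_ : c - v j = 1 * c + -1 * v j); last by ring.
  rewrite lerDr.
  by apply: sumr_ge0 => k _; exact: pos.
apply: nondecreasing_cvgn_le.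
  by apply: nondecreasing_series => k _ _; exact: pos.
apply: (@is_cvg_discounted _ (`|c| + M)) => k.
by rewrite mul1r mulN1r (le_trans (ler_normB _ _))// lerD.
Qed.

Lemma norm_discounted v M : (forall k, `|v k| <= M) -> `|discounted v| <= M.
Proof.
move=> vM; have M0 : 0 <= M by exact: le_trans (vM 0%N).
rewrite /discounted normrM (ger0_norm (ltW d1')) mulrC -ler_pdivlMr//.
have cv := is_cvg_discounted vM; rewrite -lim_norm//.
apply: limr_le; first exact: is_cvg_norm.
by apply: nearW => n; exact: discounted_norm_le.
Qed.

Section integral.
Context {d} {T : measurableType d}.
Variables (Y : nat -> T -> R) (M : R).
Hypothesis mY : forall k, measurable_fun setT (Y k).
Hypothesis YM : forall k x, `|Y k x| <= M.

Let mser n : measurable_fun setT (fun x => series (fun k => delta ^+ k * Y k x) n).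
Proof.
apply: (@measurable_sum _ _ _ _ _ _ (fun k x => delta ^+ k * Y k x)) => k.
exact: measurable_funM.
Qed.

Let mlim : measurable_fun setT (fun x => limn (series (fun k => delta ^+ k * Y k x))).
Proof.
apply: (measurable_fun_cvg mser) => x _; exact: (is_cvg_discounted (YM ^~ x)).
Qed.

Lemma bmeas_discounted : bmeas (fun x => discounted (fun k => Y k x)).
Proof.
split; first exact: measurable_funM.
by exists M => x; exact: norm_discounted.
Qed.

(** Dominated convergence for the partial sums, whose integrals are finite sums. *)
Lemma Rintegral_discounted (mu : {measure set T -> \bar R}) : mu setT = 1%E ->
  \int[mu]_x discounted (fun k => Y k x) =
  discounted (fun k => \int[mu]_x Y k x).
Proof.
move=> mu1; have bY k : bmeas (fun x => delta ^+ k * Y k x).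
  by apply: bmeasZ; split => //; exists M.
have bl : bmeas (fun x => limn (series (fun k => delta ^+ k * Y k x))).
  have := bmeasZ (1 - delta)^-1 bmeas_discounted.
  by congr bmeas; apply/funext => x; rewrite /discounted mulKf// gt_eqF.
rewrite /discounted bmeas_RintegralZ//; congr (_ * _); apply/esym/cvg_lim => //.
have := @Rintegral_cvg _ _ _ _ mu1 _ _ (M / (1 - delta)) mser mlim
  (fun n x => discounted_norm_le n (YM ^~ x)) (aeW _ (fun x => is_cvg_discounted (YM ^~ x))).
rewrite (_ : (fun n => \int[mu]_x _) =
  series (fun k => delta ^+ k * \int[mu]_x Y k x)); first exact.
apply/funext => n; rewrite /series/= bmeas_Rintegral_sum//.
by apply: eq_bigr => k _; rewrite bmeas_RintegralZ//; split=> //; exists M.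
Qed.

Lemma expectation_discounted (P : probability T R) :
  (1 - delta) * fine ('E_P[(fun x => \big[+%R/0]_(0 <= k <oo) (delta ^+ k * Y k x))%R])%E
  = discounted (fun k => \int[P]_x Y k x).
Proof.
rewrite -Rintegral_discounted; last exact: probability_setT.
rewrite unlock /discounted bmeas_RintegralZ//; first exact: probability_setT.
have := bmeasZ (1 - delta)^-1 bmeas_discounted.
by congr bmeas; apply/funext => x; rewrite /discounted mulKf// gt_eqF.
Qed.

End integral.

End discounting.

Lemma bmeas_kernel d d' (X : measurableType d) (Y : measurableType d')
    (R : realType) (k : R.-pker X ~> Y) (g : Y -> R) :
  bmeas g -> bmeas (fun x => \int[k x]_y g y).
Proof.
move=> bg; have [mg [M gM]] := bg.
split; last first.
  by exists M => x; apply: Rintegral_norm_le => //; exact: prob_kernel.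
have gM0 y : 0 <= g y + M by have := gM y; rewrite ler_norml => /andP[]; lra.
have bgM : bmeas (fun y => g y + M) by apply: bmeasD => //; exact: bmeas_cst.
(* Measurability of kernel integrals is applied to a nonnegative function, so [g] is shifted up by
   its bound; as [k x] has mass one the shift adds exactly [M]. *)
rewrite (_ : (fun x => _) = fun x => \int[k x]_y (g y + M) - M); last first.
  apply/funext => x; rewrite bmeas_RintegralD// ?Rintegral_cst1 ?addrK//;
    by [exact: prob_kernel | exact: bmeas_cst].
apply: measurable_funB => //; apply: (measurableT_comp (f := fine)) => //.
apply: (@measurable_fun_integral_kernel _ _ _ _ _ _ _ (fun y => (g y + M)%:E)) => //.
- exact: measurable_kernel.
- by apply/measurable_EFinP; case: bgM.
Qed.

(** * The controlled Markov chain *)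

Lemma bmeas_bigmax d (T : measurableType d) (R : realType) (I : Type) (s : seq I)
    (f : T -> R) (h : I -> T -> R) : bmeas f -> (forall i, bmeas (h i)) ->
  bmeas (fun x => \big[Num.max/f x]_(i <- s) h i x).
Proof.
move=> bf bh; elim: s => [|i s ih]; first by under eq_fun do rewrite big_nil.
by under eq_fun do rewrite big_cons; exact: bmeas_max.
Qed.

Lemma bmeas_discrete (R : realType) (X : pointedFinType) (g : discrete X -> R) :
  bmeas g.
Proof.
split; first by move=> _ B _.
exists (\sum_(y : X) `|g y|) => y; rewrite (bigD1 (y : X))//= lerDl.
exact: sumr_ge0.
Qed.

(** * Payoffs as functions of the worldview *)

Section payoffs.
Variables (R : realType) (n : nat) (X : pointedFinType).
Variable u : 'I_n.+1 -> X -> R.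
Implicit Types alpha : simplex R n.

(** Payoffs are finite sums of products of a weight and a function of the action. This separation
    handles expressions in which both worldview and action vary. *)
Definition weight (j : 'I_n.+1) alpha : R := tnth (sval alpha) j.

Lemma weight_ge0 j alpha : 0 <= weight j alpha.
Proof. by have /andP[/forallP/(_ j)] := svalP alpha. Qed.

Lemma sum_weight alpha : \sum_j weight j alpha = 1.
Proof. by have /andP[_ /eqP] := svalP alpha. Qed.

Lemma weight_le1 j alpha : weight j alpha <= 1.
Proof.
rewrite -(sum_weight alpha) (bigD1 j)//= lerDl.
by apply: sumr_ge0 => i _; exact: weight_ge0.
Qed.

Lemma bmeas_weight j : bmeas (weight j).
Proof.
split; last by exists 1 => al; rewrite ger0_norm ?weight_ge0 ?weight_le1.
apply: (measurableT_comp (measurable_tnth j)) => _ B mB.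
by exists B.
Qed.

Lemma UvalE alpha y : Uval u alpha y = \sum_j weight j alpha * u j y.
Proof. by []. Qed.

Lemma bmeas_Uval y : bmeas (fun alpha => Uval u alpha y).
Proof.
apply: bmeas_sum => j; apply: bmeasM; first exact: bmeas_weight.
exact: bmeas_cst.
Qed.

Lemma Uval_bounded : exists M : R, forall alpha y, `|Uval u alpha y| <= M.
Proof.
exists (\sum_j \sum_y `|u j y|) => al y.
rewrite UvalE (le_trans (ler_norm_sum _ _ _))//; apply: ler_sum => j _.
rewrite normrM ger0_norm ?weight_ge0// -[leRHS]mul1r.
apply: ler_pM; rewrite ?weight_ge0 ?weight_le1//.
by rewrite (bigD1 y)//= lerDl; exact: sumr_ge0.
Qed.

Lemma Uval_le_hval alpha y : Uval u alpha y <= hval u alpha.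
Proof. exact: le_bigmax. Qed.

Lemma hval_attained alpha : exists y, hval u alpha = Uval u alpha y.
Proof.
rewrite /hval; elim/big_ind: _ => [|r s [y ->] [z ->]|y _].
- by exists point.
- by case: leP => _; [exists z | exists y].
- by exists y.
Qed.

Lemma hval_zstar alpha y : zstar u alpha y -> Uval u alpha y = hval u alpha.
Proof.
move=> zy; apply/eqP; rewrite eq_le Uval_le_hval/=.
by have [z ->] := hval_attained alpha; exact: zy.
Qed.

Lemma bmeas_hval : bmeas (hval u).
Proof.
by apply: bmeas_bigmax => *; exact: bmeas_Uval.
Qed.

End payoffs.

Section chain.
Variables (R : realType) (n : nat) (X : pointedFinType).
Variable Pi : R.-pker simplex R n ~> (discrete X * simplex R n)%type.
Implicit Types (f : simplex R n -> R) (g : discrete X -> R) (alpha : simplex R n).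

(** The operator T, written against the joint law [Pi alpha], so that one-step identities for states
    and actions share one integral; [AvalE] relates it to [k_marginal]. *)
Definition next_mean f alpha : R := \int[Pi alpha]_z f z.2.
Definition action_mean g alpha : R := \int[Pi alpha]_z g z.1.

Let Pi1 alpha : Pi alpha setT = 1%E. Proof. exact: prob_kernel. Qed.

Lemma bmeas_snd f : bmeas f ->
  bmeas (fun z : discrete X * simplex R n => f z.2).
Proof. by move=> bf; apply: bmeas_comp bf _; exact: measurable_snd. Qed.

Lemma bmeas_fst g : bmeas (fun z : discrete X * simplex R n => g z.1).
Proof. by apply: bmeas_comp (bmeas_discrete g) _; exact: measurable_fst. Qed.

Lemma bmeas_next_mean f : bmeas f -> bmeas (next_mean f).
Proof. by move=> bf; apply: bmeas_kernel; exact: bmeas_snd. Qed.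

Lemma bmeas_action_mean g : bmeas (action_mean g).
Proof. by apply: bmeas_kernel; exact: bmeas_fst. Qed.

Lemma bmeas_iter_next_mean k f : bmeas f -> bmeas (iter k next_mean f).
Proof. by move=> bf; elim: k => [//|k ih]; exact: bmeas_next_mean. Qed.

Lemma next_mean_le f1 f2 : bmeas f1 -> bmeas f2 -> (forall al, f1 al <= f2 al) ->
  forall al, next_mean f1 al <= next_mean f2 al.
Proof. by move=> *; apply: bmeas_le_Rintegral => //; exact: bmeas_snd. Qed.

Lemma next_mean_cst c alpha : next_mean (fun=> c) alpha = c.
Proof. exact: Rintegral_cst1. Qed.

Lemma norm_iter_next_mean k f M : bmeas f -> (forall al, `|f al| <= M) ->
  forall al, `|iter k next_mean f al| <= M.
Proof.
move=> bf fM; elim: k => [//|k ih] al; apply: Rintegral_norm_le => // [|z].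
  by apply: bmeas_snd; exact: bmeas_iter_next_mean.
exact: ih.
Qed.

Lemma iter_next_mean_le k f c : bmeas f -> (forall al, f al <= c) ->
  forall al, iter k next_mean f al <= c.
Proof.
move=> bf fc; elim: k => [//|k ih] al /=; rewrite -[leRHS](next_mean_cst c al).
apply: next_mean_le => //; first exact: bmeas_iter_next_mean.
exact: bmeas_cst.
Qed.

Lemma action_mean_le g c : (forall y, g y <= c) -> forall al, action_mean g al <= c.
Proof.
move=> gc al; rewrite -[leRHS](Rintegral_cst1 (Pi1 al)).
by apply: bmeas_le_Rintegral => //; [exact: bmeas_fst | exact: bmeas_cst].
Qed.

Lemma norm_action_mean g M : (forall y, `|g y| <= M) -> forall al, `|action_mean g al| <= M.
Proof. by move=> gM al; apply: Rintegral_norm_le => //; exact: bmeas_fst. Qed.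

Lemma iter_next_mean_sum k (w : 'I_n.+1 -> R) (f : 'I_n.+1 -> simplex R n -> R) al :
  (forall j, bmeas (f j)) ->
  iter k next_mean (fun be => \sum_j w j * f j be) al = \sum_j w j * iter k next_mean (f j) al.
Proof.
move=> bf; elim: k al => [//|k ih] al /=.
rewrite (_ : iter k next_mean _ = fun be => \sum_j w j * iter k next_mean (f j) be); last first.
  by apply/funext => be; exact: ih.
have b j : bmeas (fun z : discrete X * simplex R n => iter k next_mean (f j) z.2).
  by apply: bmeas_snd; exact: bmeas_iter_next_mean.
rewrite /next_mean bmeas_Rintegral_sum//; last by move=> j; exact: bmeasZ.
by apply: eq_bigr => j _; rewrite bmeas_RintegralZ.
Qed.

Lemma action_mean_sum (w : 'I_n.+1 -> R) (u : 'I_n.+1 -> X -> R) al :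
  action_mean (fun y => \sum_j w j * u j y) al = \sum_j w j * action_mean (u j) al.
Proof.
have b j : bmeas (fun z : discrete X * simplex R n => u j z.1).
  exact: (bmeas_fst (u j)).
rewrite /action_mean bmeas_Rintegral_sum//; last by move=> j; exact: bmeasZ.
by apply: eq_bigr => j _; rewrite bmeas_RintegralZ.
Qed.

(** * The Markov property along the process *)

Section laws.
Context {d} {Omega : measurableType d}.
Variable P : simplex R n -> probability Omega R.
Variable x : nat -> {mfun Omega >-> discrete X}.
Variable a : nat -> {mfun Omega >-> simplex R n}.
Hypothesis Pfollows : follows Pi P x a.

Lemma history_sigma t : sigma_algebra setT (history x a t).
Proof. exact: smallest_sigma_algebra. Qed.

Lemma history_measurable t : history x a t `<=` measurable.
Proof.
apply: smallest_sub; first exact: sigma_algebra_measurable.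
by move=> _ [|] [i _ [B mB <-]]; apply: measurable_funP.
Qed.

Lemma history_incr s t : (s <= t)%N -> history x a s `<=` history x a t.
Proof.
move=> st; apply: sub_sigma_algebra2; apply: setUSS => A [i /= it [B mB <-]].
  by exists i; [exact: leq_trans it st | exists B].
by exists i; [exact: leq_trans it st | exists B].
Qed.

Lemma history_state t (B : set (simplex R n)) : measurable B ->
  history x a t (a t @^-1` B).
Proof.
move=> mB; apply: sub_sigma_algebra; right; exists t => //=.
by exists B => //; rewrite setTI.
Qed.

Lemma adapted_state t f : measurable_fun setT f ->
  adapted_to (history x a t) (fun w => f (a t w)).
Proof.
move=> mf B mB; apply: (history_state (B := f @^-1` B)).
by rewrite -[X in measurable X]setTI; exact: mf.
Qed.

Lemma bmeas_state t f : bmeas f -> bmeas (fun w => f (a t w)).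
Proof. by move=> bf; apply: bmeas_comp bf _; exact: measurable_funP. Qed.

Lemma bmeas_action t g : bmeas (fun w => g (x t w)).
Proof. by apply: bmeas_comp (bmeas_discrete g) _; exact: measurable_funP. Qed.

Variable beta : simplex R n.
Let Pb := P beta.
Let Pb1 : Pb setT = 1%E. Proof. exact: probability_setT. Qed.

(** [follows] gives this for indicators. The difference of the two sides is linear in [h] and at
    most [1 + 1] on functions with values in [0, 1], so [bmeas_functional_eq0] applies. *)
Lemma one_step t A (h : discrete X * simplex R n -> R) : history x a t A ->
  bmeas h ->
  \int[Pb]_(w in A) h (x t w, a t.+1 w) =
  \int[Pb]_(w in A) \int[Pi (a t w)]_z h z.
Proof.
move=> FA bh; have mA := history_measurable FA.
have mxa : measurable_fun setT (fun w => (x t w, a t.+1 w)).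
  by apply/measurable_fun_pairP; split; exact: measurable_funP.
have b1 (f : discrete X * simplex R n -> R) : bmeas f -> bmeas (fun w => f (x t w, a t.+1 w)).
  by move=> bf; exact: bmeas_comp bf mxa.
have b2 (f : discrete X * simplex R n -> R) : bmeas f -> bmeas (fun w => \int[Pi (a t w)]_z f z).
  move=> bf; apply: (@bmeas_state t (fun al => \int[Pi al]_z f z)).
  exact: bmeas_kernel.
pose e (f : discrete X * simplex R n -> R) := \int[Pb]_(w in A) f (x t w, a t.+1 w) -
            \int[Pb]_(w in A) \int[Pi (a t w)]_z f z.
apply/eqP; rewrite -subr_eq0 -/(e h); apply/eqP.
apply: (@bmeas_functional_eq0 _ _ _ e (1 + 1) _ _ _ _ h bh).
- move=> f g bf bg; rewrite /e.
  have := (b1 _ bf, b1 _ bg, b2 _ bf, b2 _ bg) => -[[[b1f b1g] b2f] b2g].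
  under [X in _ - X = _]eq_Rintegral do rewrite bmeas_RintegralD//.
  by rewrite !bmeas_RintegralD//; ring.
- move=> c f bf; rewrite /e; have := (b1 _ bf, b2 _ bf) => -[b1f b2f].
  under [X in _ - X = _]eq_Rintegral do rewrite bmeas_RintegralZ//.
  by rewrite !bmeas_RintegralZ//; ring.
- move=> D mD; rewrite /e; apply/eqP; rewrite subr_eq0; apply/eqP.
  have [_ _ /(_ _ FA) ce] := (Pfollows beta).2 t D mD.
  rewrite /Rintegral; congr fine; rewrite ce; apply: eq_integral => w _.
  by rewrite integral_indic// setIT.
- move=> f bf f01; have fn z : `|f z| <= 1.
    by have /andP[f0 f1] := f01 z; rewrite ger0_norm.
  rewrite (le_trans (ler_normB _ _))// lerD// Rintegral_norm_le//.
  + exact: b1 bf.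
  + exact: b2 bf.
  + by move=> w; apply: Rintegral_norm_le.
Qed.

(** The induction hypothesis is used from time [s.+1], with [A] seen as an event of the longer
    history; [one_step] then goes back to time [s]. *)
Lemma state_law s k A f : history x a s A -> bmeas f ->
  \int[Pb]_(w in A) f (a (s + k)%N w) = \int[Pb]_(w in A) iter k next_mean f (a s w).
Proof.
elim: k s A => [|k ih] s A FA bf; first by rewrite addn0.
rewrite addnS -addSn ih//; last by apply: history_incr FA.
rewrite (one_step (h := fun z => iter k next_mean f z.2) FA)//.
by apply: bmeas_snd; exact: bmeas_iter_next_mean.
Qed.

Lemma action_law s k A g : history x a s A ->
  \int[Pb]_(w in A) g (x (s + k)%N w) =
  \int[Pb]_(w in A) iter k next_mean (action_mean g) (a s w).
Proof.
move=> FA; rewrite -state_law//; last exact: bmeas_action_mean.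
rewrite (one_step (h := fun z => g z.1))//; last exact: bmeas_fst.
by apply: history_incr FA; exact: leq_addr.
Qed.

(** A factor known at time [s] passes through conditioning: for an indicator this is [action_law] on
    an event about [a s], and [bmeas_functional_eq0] extends it to all [f]. *)
Lemma weighted_action_law s k f g : bmeas f ->
  \int[Pb]_w (f (a s w) * g (x (s + k)%N w)) =
  \int[Pb]_w (f (a s w) * iter k next_mean (action_mean g) (a s w)).
Proof.
move=> bf; pose Y w := g (x (s + k)%N w) - iter k next_mean (action_mean g) (a s w).
have b1 : bmeas (fun w => g (x (s + k)%N w)) by exact: bmeas_action.
have b2 : bmeas (fun w => iter k next_mean (action_mean g) (a s w)).
  by apply: bmeas_state; apply: bmeas_iter_next_mean; exact: bmeas_action_mean.
have bY : bmeas Y by exact: bmeasB.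
have b3 f' : bmeas f' -> bmeas (fun w => f' (a s w) * Y w).
  by move=> bf'; apply: bmeasM => //; exact: bmeas_state.
have [M YM] := bY.2.
apply/eqP; rewrite -subr_eq0 -bmeas_RintegralB//; last 2 first.
- by apply: bmeasM => //; exact: bmeas_state.
- by apply: bmeasM => //; exact: bmeas_state.
under eq_Rintegral do rewrite -mulrBr.
apply/eqP; apply: (@bmeas_functional_eq0 _ _ _
  (fun f => \int[Pb]_w (f (a s w) * Y w)) M _ _ _ _ f bf).
- move=> f1 f2 bf1 bf2; under eq_Rintegral do rewrite mulrDl.
  by rewrite bmeas_RintegralD//; exact: b3.
- move=> c f1 bf1; under eq_Rintegral do rewrite -mulrA.
  by rewrite bmeas_RintegralZ//; exact: b3.
- move=> D mD; have FD := @history_state s _ mD.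
  transitivity (\int[Pb]_(w in a s @^-1` D) Y w).
    rewrite [RHS]Rintegral_mkcond; apply: eq_Rintegral => w _.
    rewrite patchE indicE (_ : (a s w \in D) = (w \in a s @^-1` D)); last first.
      by apply/idP/idP; rewrite !inE.
    by case: (w \in _); rewrite ?mul1r ?mul0r.
  rewrite bmeas_RintegralB//; last exact: (history_measurable FD).
  by rewrite action_law// subrr.
- move=> f1 bf1 f01; apply: Rintegral_norm_le => //; first exact: b3.
  move=> w; rewrite normrM -[leRHS]mul1r ler_pM//.
  by have /andP[f0 f1'] := f01 (a s w); rewrite ger0_norm.
Qed.

Lemma initial_law f : bmeas f -> \int[Pb]_w f (a 0%N w) = f beta.
Proof.
move=> bf; rewrite -[RHS](Rintegral_cst1 Pb1) /Rintegral; congr fine.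
apply: ae_eq_integral => //.
- by apply/measurable_EFinP; case: (bmeas_state 0 bf).
- by have [a0 _] := Pfollows beta; apply: filterS a0 => w -> _.
Qed.

Lemma mean_state_law k f : bmeas f -> \int[Pb]_w f (a k w) = iter k next_mean f beta.
Proof.
move=> bf; rewrite -initial_law; last exact: bmeas_iter_next_mean.
by rewrite -state_law//; case: (history_sigma 0%N) => h0 hC _;
  rewrite -(setD0 setT); exact: hC.
Qed.

Lemma mean_action_law k g : \int[Pb]_w g (x k w) = iter k next_mean (action_mean g) beta.
Proof.
rewrite -initial_law; last by apply: bmeas_iter_next_mean; exact: bmeas_action_mean.
by rewrite -action_law//; case: (history_sigma 0%N) => h0 hC _;
  rewrite -(setD0 setT); exact: hC.
Qed.

End laws.
End chain.

(** * The equilibrium inequality *)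

Section equilibrium.
Variables (R : realType) (n : nat) (X : pointedFinType).
Variables (u : 'I_n.+1 -> X -> R) (delta lambda : R).
Hypotheses (delta01 : 0 < delta < 1) (lambda01 : 0 < lambda < 1).
Variable Pi : R.-pker simplex R n ~> (discrete X * simplex R n)%type.
Context {d : measure_display} {Omega : measurableType d}.
Variable P : simplex R n -> probability Omega R.
Variable x : nat -> {mfun Omega >-> discrete X}.
Variable a : nat -> {mfun Omega >-> simplex R n}.
Hypothesis Pfollows : follows Pi P x a.
Hypothesis mpe : stationary_MPE Pi P x a u delta lambda.
Variable M : R.
Hypothesis UM : forall alpha y, `|Uval u alpha y| <= M.
Implicit Types alpha beta : simplex R n.

Local Notation T := (next_mean Pi).
Local Notation h := (hval u).
Local Notation H := (Hval P a u delta).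
Local Notation Q := (Qval P x u delta).

Let P1 beta : P beta setT = 1%E. Proof. exact: probability_setT. Qed.
Let Pi1 alpha : Pi alpha setT = 1%E. Proof. exact: prob_kernel. Qed.

(* [lagged k alpha] is [E_alpha U(alpha, x_k)], with [alpha] frozen in [U]. *)
Definition lagged k alpha : R := iter k T (action_mean Pi (Uval u alpha)) alpha.

Lemma iter_action_mean_Uval k alpha beta :
  iter k T (action_mean Pi (Uval u alpha)) beta =
  \sum_j weight j alpha * iter k T (action_mean Pi (u j)) beta.
Proof.
rewrite (_ : action_mean Pi (Uval u alpha) = fun be =>
    \sum_j weight j alpha * action_mean Pi (u j) be).
  by rewrite iter_next_mean_sum// => j; exact: bmeas_action_mean.
by apply/funext => be; rewrite -action_mean_sum.
Qed.

Lemma norm_hval alpha : `|h alpha| <= M.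
Proof. by have [y ->] := hval_attained u alpha. Qed.

Lemma norm_iter_hval k alpha : `|iter k T h alpha| <= M.
Proof. by apply: norm_iter_next_mean; [exact: bmeas_hval | exact: norm_hval]. Qed.

Lemma norm_iter_Uval k alpha beta :
  `|iter k T (action_mean Pi (Uval u alpha)) beta| <= M.
Proof.
apply: norm_iter_next_mean; first exact: bmeas_action_mean.
by move=> be; exact: norm_action_mean.
Qed.

Lemma bmeas_lagged k : bmeas (lagged k).
Proof.
rewrite (_ : lagged k = fun al =>
    \sum_j weight j al * iter k T (action_mean Pi (u j)) al).
  apply: bmeas_sum => j; apply: bmeasM; first exact: bmeas_weight.
  by apply: bmeas_iter_next_mean; exact: bmeas_action_mean.
by apply/funext => al; exact: iter_action_mean_Uval.
Qed.

(** With [alpha] frozen, [h alpha] is a constant bound on the payoff, and averaging preserves it. *)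
Lemma lagged_le_hval k alpha : lagged k alpha <= h alpha.
Proof.
apply: iter_next_mean_le; first exact: bmeas_action_mean.
by apply: action_mean_le => y; exact: Uval_le_hval.
Qed.

(** Optimality of play: [Pi alpha] gives mass one to the actions in [zstar u alpha], on which the
    payoff equals [h alpha]. *)
Lemma lagged0 alpha : lagged 0 alpha = h alpha.
Proof.
have mB : measurable (fst @^-1` (zstar u alpha) : set (discrete X * simplex R n)).
  by rewrite -[X in measurable X]setTI; exact: measurable_fst.
have B1 : Pi alpha (fst @^-1` (zstar u alpha)) = 1%E := (mpe alpha).1.
rewrite /lagged/= -[RHS](Rintegral_cst1 (Pi1 alpha)) /action_mean /Rintegral.
congr fine; apply: ae_eq_integral => //.
- by apply/measurable_EFinP; case: (bmeas_fst (R := R) n (Uval u alpha)).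
- exists (~` (fst @^-1` (zstar u alpha))); split.
  + exact: measurableC.
  + have : (Pi alpha setT = Pi alpha (fst @^-1` zstar u alpha) +
        Pi alpha (~` (fst @^-1` zstar u alpha)))%E.
      by rewrite -measureU ?setUv ?setICr//; exact: measurableC.
    rewrite Pi1 B1 => /(congr1 (fun r => r - 1)%E).
    by rewrite subee// addeAC subee// add0e.
  + move=> z /= nz zz; apply: nz => _.
    by rewrite (hval_zstar zz).
Qed.

(** The worldview [a s] is random here, so the payoff is expanded in its weights and
    [weighted_action_law] is applied to each term. *)
Lemma lagged_mean beta s k :
  \int[P beta]_w Uval u (a s w) (x (s + k)%N w) = \int[P beta]_w lagged k (a s w).
Proof.
have Pb1 := P1 beta.
have bu j : bmeas (fun w => weight j (a s w) * u j (x (s + k)%N w)).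
  apply: bmeasM; first by apply: (bmeas_state a s); exact: bmeas_weight.
  exact: (bmeas_action x (s + k) (u j)).
rewrite bmeas_Rintegral_sum//.
under [RHS]eq_Rintegral do rewrite /lagged iter_action_mean_Uval.
rewrite bmeas_Rintegral_sum//; last first.
  move=> j; apply: (@bmeas_state _ _ _ _ a s
    (fun al => weight j al * iter k T (action_mean Pi (u j)) al)).
  apply: bmeasM; first exact: bmeas_weight.
  by apply: bmeas_iter_next_mean; exact: bmeas_action_mean.
apply: eq_bigr => j _.
exact: (@weighted_action_law _ _ _ _ _ _ _ _ _ Pfollows beta s k (weight j)
  (u j) (bmeas_weight R j)).
Qed.

Lemma HvalE beta : H beta = discounted delta (fun k => iter k T h beta).
Proof.
rewrite /Hval (@expectation_discounted _ _ delta01 _ _ (fun k w => h (a k w)) M).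
- congr discounted; apply/funext => k.
  by rewrite (mean_state_law Pfollows)//; exact: bmeas_hval.
- by move=> k; case: (bmeas_state a k (bmeas_hval u)).
- by move=> k w; exact: norm_hval.
Qed.

(** The sum defining [Q] starts at index 1 with exponent [k.-1]; reindexing from 0 turns the lag
    into [k.+1]. *)
Lemma QvalE alpha : Q alpha = discounted delta (fun k => lagged k.+1 alpha).
Proof.
have bU k : bmeas (fun w => Uval u alpha (x k w)).
  exact: (bmeas_action x k (Uval u alpha)).
rewrite /Qval (_ : (fun w => _) = fun w =>
    \big[+%R/0]_(0 <= k <oo) (delta ^+ k * Uval u alpha (x k.+1 w))).
  rewrite (@expectation_discounted _ _ delta01 _ _
    (fun k w => Uval u alpha (x k.+1 w)) M)//.
    congr discounted; apply/funext => k.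
    exact: (mean_action_law Pfollows alpha k.+1 (Uval u alpha)).
  by move=> k; case: (bU k.+1).
apply/funext => w; apply/cvg_lim => //.
rewrite -(cvg_shiftS (fun n => \sum_(1 <= k < n) _)).
rewrite (_ : (fun n => _) =
    series (fun k => delta ^+ k * Uval u alpha (x k.+1 w))).
  exact: (is_cvg_discounted (v := fun k => Uval u alpha (x k.+1 w)) delta01 (fun=> UM _ _)).
by apply/funext => m; rewrite /series/= big_add1.
Qed.

Lemma CvalE beta alpha : (1 - delta) * Cval P x a u delta lambda beta alpha =
  (1 - lambda) * H beta +
  lambda * discounted delta (fun k => iter k T (action_mean Pi (Uval u alpha)) beta).
Proof.
have /andP[l0 l1] := lambda01; have Pb1 := P1 beta.
have b1 k : bmeas (fun w => Uval u (a k w) (x k w)).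
  apply: bmeas_sum => j; apply: bmeasM.
    exact: (bmeas_state a k (bmeas_weight R j)).
  exact: (bmeas_action x k (u j)).
have b2 k : bmeas (fun w => Uval u alpha (x k w)).
  exact: (bmeas_action x k (Uval u alpha)).
have b3 k : bmeas (fun w => (1 - lambda) * Uval u (a k w) (x k w)
                   + lambda * Uval u alpha (x k w)).
  exact: bmeasD (bmeasZ (1 - lambda) (b1 k)) (bmeasZ lambda (b2 k)).
rewrite /Cval (@expectation_discounted _ _ delta01 _ _ (fun k w =>
  (1 - lambda) * Uval u (a k w) (x k w) + lambda * Uval u alpha (x k w)) M).
- rewrite HvalE -(discounted_lin delta01 _ _ (norm_iter_hval ^~ beta)
    (fun k => norm_iter_Uval k alpha beta)).
  congr discounted; apply/funext => k.
  have := (bmeasZ (1 - lambda) (b1 k), bmeasZ lambda (b2 k)) => -[b1k b2k].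
  rewrite bmeas_RintegralD ?bmeas_RintegralZ//.
  congr (_ * _ + _ * _).
    (* At lag 0 the realised payoff has the mean of [h (a k)], because play is optimal. *)
    have := lagged_mean beta k 0; rewrite addn0 => ->.
    rewrite -(mean_state_law Pfollows)//; last exact: bmeas_hval.
    by apply: eq_Rintegral => w _; exact: lagged0.
  exact: (mean_action_law Pfollows beta k (Uval u alpha)).
- by move=> k; case: (b3 k).
- move=> k w; rewrite (le_trans (ler_normD _ _))// !normrM.
  rewrite (ger0_norm (ltW l0)) ger0_norm ?subr_ge0 ?(ltW l1)//.
  have -> : M = (1 - lambda) * M + lambda * M by ring.
  by rewrite lerD// ler_wpM2l// ?subr_ge0 ltW.
Qed.

Lemma bmeas_Hval : bmeas H.
Proof.
rewrite (_ : H = fun be => discounted delta (fun k => iter k T h be)).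
  apply: (bmeas_discounted delta01 (M := M)); last by move=> *; exact: norm_iter_hval.
  by move=> k; case: (bmeas_iter_next_mean Pi k (bmeas_hval u)).
by apply/funext => be; exact: HvalE.
Qed.

Lemma norm_Hval beta : `|H beta| <= M.
Proof. by rewrite HvalE; apply: norm_discounted => // k; exact: norm_iter_hval. Qed.

Lemma bmeas_Qval : bmeas Q.
Proof.
rewrite (_ : Q = fun al => discounted delta (fun k => lagged k.+1 al)).
  apply: (bmeas_discounted delta01 (M := M)); last by move=> *; exact: norm_iter_Uval.
  by move=> k; case: (bmeas_lagged k.+1).
by apply/funext => al; exact: QvalE.
Qed.

Lemma norm_Qval alpha : `|Q alpha| <= M.
Proof. by rewrite QvalE; apply: norm_discounted => // k; exact: norm_iter_Uval. Qed.

Lemma next_mean_discounted f N alpha : bmeas f -> (forall be, `|f be| <= N) ->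
  T (fun be => discounted delta (fun k => iter k T f be)) alpha =
  discounted delta (fun k => iter k.+1 T f alpha).
Proof.
move=> bf fN; rewrite /next_mean.
rewrite (@Rintegral_discounted _ _ delta01 _ _ (fun k z => iter k T f z.2) N)//.
- by move=> k; case: (bmeas_snd X (bmeas_iter_next_mean Pi k bf)).
- by move=> k z; exact: norm_iter_next_mean.
Qed.

(** Solved for [h], this writes [H - h] as a multiple of the drift [T H - H]. *)
Lemma Hval_rec alpha : H alpha = (1 - delta) * h alpha + delta * T H alpha.
Proof.
rewrite HvalE (discountedS delta01 (norm_iter_hval ^~ alpha)).
congr (_ + _ * _); rewrite -(@next_mean_discounted _ M).
- by congr (T _ _); apply/funext => be; rewrite HvalE.
- exact: bmeas_hval.
- exact: norm_hval.
Qed.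

Lemma AvalE alpha : Aval Pi P x a u delta lambda alpha =
  (1 - lambda) * T H alpha + lambda * Q alpha.
Proof.
pose V be := discounted delta (fun k => iter k T (action_mean Pi (Uval u alpha)) be).
have bV : bmeas V.
  apply: (bmeas_discounted delta01 (M := M)); last by move=> *; exact: norm_iter_Uval.
  by move=> k; case: (bmeas_iter_next_mean Pi k (bmeas_action_mean Pi (Uval u alpha))).
have -> : Q alpha = T V alpha.
  rewrite QvalE /V (@next_mean_discounted _ M)//; first exact: bmeas_action_mean.
  exact: norm_action_mean.
have /andP[_ d1] := delta01.
have CE be : Cval P x a u delta lambda be alpha =
    (1 - delta)^-1 * ((1 - lambda) * H be + lambda * V be).
  by rewrite -CvalE mulKf// gt_eqF// subr_gt0.
have bc : bmeas (fun be => (1 - lambda) * H be + lambda * V be).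
  by apply: bmeasD; apply: bmeasZ => //; exact: bmeas_Hval.
have bC : bmeas (fun be => Cval P x a u delta lambda be alpha).
  by rewrite (funext CE); exact: bmeasZ.
(* Change of variables from the marginal on states to the joint law. *)
rewrite /Aval /Sval (_ : \int[_]_be _ =
    T (fun be => Cval P x a u delta lambda be alpha) alpha); last first.
  rewrite /next_mean /Rintegral; congr fine.
  have := @integral_pushforward _ _ _ _ _ _ measurable_snd (Pi alpha) setT
    (fun be => (Cval P x a u delta lambda be alpha)%:E).
  rewrite preimage_setT => <-//.
  - by apply/measurable_EFinP; case: bC.
  - by apply: bmeas_integrable => //; exact: (bmeas_snd X bC).
rewrite (funext CE) /next_mean bmeas_RintegralZ//; last exact: (bmeas_snd X bc).
rewrite mulVKf ?gt_eqF ?subr_gt0//.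
have bH2 := bmeas_snd X bmeas_Hval.
have bV2 := bmeas_snd X bV.
have := (bmeasZ (1 - lambda) bH2, bmeasZ lambda bV2) => -[bH3 bV3].
rewrite bmeas_RintegralD//; congr (_ + _); exact: bmeas_RintegralZ.
Qed.

(* The equilibrium inequality at the deviation [gamma = alpha], where the
   objective is [(1 - lambda) H + lambda ((1 - delta) h + delta Q)]. *)
Lemma equilibrium_drift alpha :
  lambda * (1 - delta) * (h alpha - Q alpha) <= (1 - lambda) * (T H alpha - H alpha).
Proof.
have /andP[_ d1] := delta01.
have := (mpe alpha).2 alpha; rewrite -(ler_pM2l (x := 1 - delta)) ?subr_gt0//.
rewrite CvalE -/(Aval Pi P x a u delta lambda alpha) AvalE.
rewrite -/(lagged _ _) (discountedS delta01 (fun k => norm_iter_Uval k alpha alpha)).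
rewrite -[iter 0 _ _ _]/(lagged 0 alpha) lagged0 -QvalE.
rewrite -subr_ge0 => le; rewrite -subr_ge0; apply: le_trans le _.
by rewrite le_eqVlt; apply/orP; left; apply/eqP; ring.
Qed.

(** [h - Q] averages the gaps at lags 1, 2, and so on; lag [k.+1] has weight
    [(1 - delta) * delta ^+ k]. *)
Lemma lagged_gap k alpha :
  (1 - delta) * delta ^+ k * (h alpha - lagged k.+1 alpha) <= h alpha - Q alpha.
Proof.
rewrite QvalE; apply: (discounted_gap delta01 k (M := M) (v := fun k => lagged k.+1 alpha)) => i.
  exact: norm_iter_Uval.
exact: lagged_le_hval.
Qed.

Lemma Qval_le_hval alpha : Q alpha <= h alpha.
Proof.
have /andP[_ d1] := delta01.
rewrite -subr_ge0 (le_trans _ (lagged_gap 0 alpha))// expr0 mulr1 mulr_ge0//.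
  by rewrite subr_ge0 ltW.
by rewrite subr_ge0 lagged_le_hval.
Qed.

Lemma Hval_le_next alpha : H alpha <= T H alpha.
Proof.
have /andP[_ d1] := delta01; have /andP[l0 l1] := lambda01.
rewrite -subr_ge0 -(pmulr_rge0 _ (_ : 0 < 1 - lambda)) ?subr_gt0//.
apply: le_trans (equilibrium_drift alpha); rewrite mulr_ge0 ?subr_ge0 ?Qval_le_hval//.
by rewrite mulr_ge0 ?ltW// subr_gt0.
Qed.

Lemma Hval_le_iter k alpha : H alpha <= iter k T H alpha.
Proof.
elim: k alpha => [//|k ih] alpha; apply: le_trans (Hval_le_next alpha) _.
by apply: next_mean_le => //; [exact: bmeas_Hval | apply: bmeas_iter_next_mean; exact: bmeas_Hval].
Qed.

End equilibrium.

(** * Convergence and total loss *)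

Lemma norm_limn_sup (R : realType) (v : nat -> R) (M : R) :
  (forall k, `|v k| <= M) -> `|limn_sup v| <= M.
Proof.
move=> vM.
have vlo k : - M <= v k by have := vM k; rewrite ler_norml => /andP[].
have vhi k : v k <= M by have := vM k; rewrite ler_norml => /andP[].
have slo k : - M <= sups v k.
  apply: le_trans (vlo k) _; apply: ub_le_sup; last by exists k => /=.
  by exists M => _ [i _ <-].
have shi k : sups v k <= M.
  by apply: ge_sup; [exists (v k), k => /= | move=> _ [i _ <-]].
rewrite limn_supE; last first.
  exists M; split; first exact: num_real.
  by move=> N /ltW MN k _ /=; rewrite (le_trans (vM k)).
rewrite ler_norml; apply/andP; split.
  by apply: lb_le_inf => [|_ [k _ <-]]; first by exists (sups v 0%N), 0%N.
apply: le_trans (shi 0%N); apply: ge_inf; last by exists 0%N.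
by exists (- M) => _ [k _ <-].
Qed.

Theorem theorem9p3 (R : realType) (n : nat) (X : pointedFinType)
  (u : 'I_n.+1 -> X -> R) (delta lambda : R)
  (delta01 : 0 < delta < 1) (lambda01 : 0 < lambda < 1)
  (Pi : R.-pker simplex R n ~> (discrete X * simplex R n)%type)
  (d : measure_display) (Omega : measurableType d)
  (P : simplex R n -> probability Omega R)
  (x : nat -> {mfun Omega >-> discrete X})
  (a : nat -> {mfun Omega >-> simplex R n})
  (Pfollows : follows Pi P x a)
  (mpe : stationary_MPE Pi P x a u delta lambda)
  (alpha0 : simplex R n) :
  let Ht := fun t w => Hval P a u delta (a t w) in
  let ht := fun t w => hval u (a t w) in
  let At := fun t w => Aval Pi P x a u delta lambda (a t w) in
  let Qt := fun t w => Qval P x u delta (a t w) in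
  let loss := fun k t w => hval u (a t w) - Uval u (a t w) (x (t + k)%N w) in
  [/\ submartingale (P alpha0) (history x a) Ht,
      exists M : R, forall t w, `|Ht t w| <= M &
      exists L : {mfun Omega >-> R},
        [/\ exists M : R, forall w, `|L w| <= M,
            [/\ cvg_as_and_L1 (P alpha0) Ht L,
                cvg_as_and_L1 (P alpha0) ht L,
                cvg_as_and_L1 (P alpha0) At L &
                cvg_as_and_L1 (P alpha0) Qt L] &
            forall k : nat, (1 <= k)%N ->
              [/\ forall t w, 0 <= loss k t w,
                  (\int[P alpha0]_w (\sum_(0 <= t <oo) (loss k t w)%:E) <=
                   ((1 - lambda) * (fine 'E_(P alpha0)[L] - Hval P a u delta alpha0)
                    / (lambda * (1 - delta) ^+ 2 * delta ^+ k.-1))%:E)%E &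
                  {ae P alpha0, forall w, cvgn (series (fun t => loss k t w))}]]].
Proof.
move=> Ht ht At Qt loss.
have [M UM] := Uval_bounded u.
have Pa1 : P alpha0 setT = 1%E by exact: probability_setT.
have /andP[d0 d1] := delta01; have /andP[l0 l1] := lambda01.
have d1' : 0 < 1 - delta by rewrite subr_gt0.
have l1' : 0 < 1 - lambda by rewrite subr_gt0.
pose H := Hval P a u delta; pose TH := next_mean Pi H; pose Q := Qval P x u delta.
have bH : bmeas H := bmeas_Hval delta01 Pfollows UM.
have bTH : bmeas TH by exact: bmeas_next_mean.
have bQ : bmeas Q := bmeas_Qval delta01 Pfollows UM.
have HM al : `|H al| <= M := norm_Hval delta01 Pfollows UM al.
have THM al : `|TH al| <= M := @norm_iter_next_mean _ _ _ Pi 1 _ _ bH HM al.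
have QM al : `|Q al| <= M := norm_Qval delta01 Pfollows UM al.
have AE al : Aval Pi P x a u delta lambda al = (1 - lambda) * TH al + lambda * Q al.
  exact: (AvalE delta01 lambda01 Pfollows mpe UM).
have Hrec al : H al = (1 - delta) * hval u al + delta * TH al.
  exact: (Hval_rec delta01 Pfollows UM).
have drift al : lambda * (1 - delta) * (hval u al - Q al) <= (1 - lambda) * (TH al - H al).
  exact: (equilibrium_drift delta01 lambda01 Pfollows mpe UM).
have HTH al : H al <= TH al := Hval_le_next delta01 lambda01 Pfollows mpe UM al.
have Qh al : Q al <= hval u al := Qval_le_hval delta01 Pfollows UM al.
have bHt t : bmeas (Ht t) := bmeas_state a t bH.
(* The drift: the conditional mean increment of [Ht] at time [t]. *)
pose D t w := TH (a t w) - H (a t w).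
have D0 t w : 0 <= D t w by rewrite subr_ge0.
have bD t : bmeas (D t).
  exact: (bmeasB (bmeas_state a t bTH) (bmeas_state a t bH)).
have condH s k A : history x a s A ->
    \int[P alpha0]_(w in A) Ht (s + k)%N w =
    \int[P alpha0]_(w in A) iter k (next_mean Pi) H (a s w).
  by move=> FA; exact: (state_law Pfollows alpha0 k FA bH).
have FT s : history x a s setT.
  by case: (history_sigma x a s) => h0 hC _; rewrite -(setD0 setT); exact: hC.
have ED t : \int[P alpha0]_w D t w =
    \int[P alpha0]_w Ht t.+1 w - \int[P alpha0]_w Ht t w.
  rewrite bmeas_RintegralB//; [|exact: bmeas_state..].
  by have := condH t 1%N setT (FT t); rewrite addn1 => ->.
have sumED N : \sum_(0 <= t < N) \int[P alpha0]_w D t w =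
    \int[P alpha0]_w Ht N w - H alpha0.
  rewrite (eq_bigr _ (fun t _ => ED t)) telescope_sumr//; congr (_ - _).
  exact: (initial_law Pfollows).
have subm : submartingale (P alpha0) (history x a) Ht.
  split.
  - by move=> t; apply: adapted_state; case: bH.
  - by move=> t; exact: bmeas_integrable.
  (* By the Markov property, this iterate at [a s] is a version of the conditional expectation of
     [Ht t]. *)
  - move=> s t st; exists (fun w => iter (t - s) (next_mean Pi) H (a s w)).
    have bI := bmeas_iter_next_mean Pi (t - s) bH.
    split; last first.
      by apply: aeW => w; exact: (Hval_le_iter delta01 lambda01 Pfollows mpe UM).
    split.
    + by apply: adapted_state; case: bI.
    + by apply: bmeas_integrable => //; exact: bmeas_state.
    + move=> A FA; have mA := history_measurable FA.
      rewrite !bmeas_RintegralE//; last exact: bmeas_state.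
      by rewrite -condH// subnKC.
split=> //; first by exists M => t w; exact: HM.
have cvgH : {ae P alpha0, forall w, cvgn (fun t => Ht t w)}.
  apply: (@submartingale_cvg _ _ _ (P alpha0) (history x a) Ht M).
  - exact: history_sigma.
  - exact: history_measurable.
  - by move=> t; exact: history_incr.
  - by case: subm.
  - by move=> t w; exact: HM.
  - move=> t A FA; have mA := history_measurable FA.
    rewrite -[t.+1]addn1 condH//; apply: bmeas_le_Rintegral => //.
      exact: bmeas_state.
    by move=> w; exact: HTH.
(* The upper limit is measurable and bounded by [M] at every point, and equals the limit wherever
   that exists. *)
pose L0 w : R := limn_sup (fun t => Ht t w).
have L0M w : `|L0 w| <= M by apply: norm_limn_sup => i; exact: HM.
have mL0 : measurable_fun setT L0.
  apply: measurable_fun_limn_sup => [w _|w _|i]; last by case: (bHt i).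
    by exists M => _ [i _ <-]; exact: le_trans (ler_norm _) (HM _).
  by exists (- M) => _ [t _ <-]; have := HM (a t w); rewrite ler_norml => /andP[].
pose L : {mfun Omega >-> R} := HB.pack L0 (isMeasurableFun.Build _ _ _ _ L0 mL0).
have HL : {ae P alpha0, forall w, Ht t w @[t --> \oo] --> L w}.
  by apply: filterS cvgH => w cw; rewrite /L/= /L0 (cvg_limn_supE cw).
have DL : {ae P alpha0, forall w, D t w @[t --> \oo] --> (0 : R)}.
  have : {ae P alpha0, forall w, cvgn (series (fun t => D t w))}.
    (* The mean drifts telescope to a difference of two numbers of size at most [M]. *)
    apply: (@ae_cvg_series _ _ _ (P alpha0) D (M + M)) => // N.
    rewrite sumED; apply: lerD; apply: le_trans (ler_norm _) _.
      exact: (Rintegral_norm_le Pa1 measurableT (bHt N) (fun w => HM _)).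
    by rewrite normrN; exact: HM.
  by apply: filterS => w; exact: cvg_series_cvg_0.
have hL : {ae P alpha0, forall w, ht t w @[t --> \oo] --> L w}.
  apply: filterS2 HL DL => w Hw Dw.
  have -> : ht ^~ w = fun t => Ht t w - delta / (1 - delta) * D t w.
    apply/funext => t; rewrite /ht /Ht /D -/H (Hrec (a t w)); field.
    by rewrite gt_eqF.
  rewrite -[L w]subr0 -(mulr0 (delta / (1 - delta))).
  by apply: cvgB => //; exact: cvgMr.
have QL : {ae P alpha0, forall w, Qt t w @[t --> \oo] --> L w}.
  apply: filterS2 hL DL => w hw Dw.
  (* The constant for which [drift] reads [h - Q <= c * D], squeezing [Q] between [h - c * D] and
     [h]. *)
  pose c := (1 - lambda) / (lambda * (1 - delta)).
  apply: (@squeeze_cvgr _ _ _ _ (fun t => ht t w - c * D t w) (fun t => ht t w)) => //.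
    apply: nearW => t; rewrite Qh andbT lerBlDr -lerBlDl.
    rewrite /c mulrAC ler_pdivlMr ?mulr_gt0// mulrC; exact: drift.
  by rewrite -[L w]subr0 -(mulr0 c); apply: cvgB => //; exact: cvgMr.
have AL : {ae P alpha0, forall w, At t w @[t --> \oo] --> L w}.
  apply: filterS3 HL DL QL => w Hw Dw Qw.
  (* In the formula for [A], the term [T H] is [H] plus the drift, which vanishes in the limit. *)
  have -> : At ^~ w = fun t => (1 - lambda) * (Ht t w + D t w) + lambda * Qt t w.
    by apply/funext => t; rewrite /At AE /Ht /D /Qt -/H -/Q; ring.
  have -> : L w = (1 - lambda) * (L w + 0) + lambda * L w by ring.
  by apply: cvgD; apply: cvgMr => //; exact: cvgD.
exists L; split; first by exists M.
  split; apply: (@cvg_as_and_L1_bounded _ _ _ _ _ _ M) => //.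
  - by move=> t; case: (bHt t).
  - by move=> t w; exact: HM.
  - by move=> t; case: (bmeas_state a t (bmeas_hval u)).
  - by move=> t w; exact: norm_hval.
  - move=> t; rewrite (_ : At t = fun w =>
      (1 - lambda) * TH (a t w) + lambda * Q (a t w)); last by apply/funext => w; exact: AE.
    by have [] := bmeasD (bmeasZ (1 - lambda) (bmeas_state a t bTH))
                         (bmeasZ lambda (bmeas_state a t bQ)).
  - move=> t w; rewrite /At AE (le_trans (ler_normD _ _))// (normrM (1 - lambda)) (normrM lambda).
    rewrite (ger0_norm (ltW l0)) (ger0_norm (ltW l1')).
    apply: (@le_trans _ _ ((1 - lambda) * M + lambda * M)); last by rewrite -mulrDl subrK mul1r.
    by apply: lerD; apply: ler_wpM2l; [exact: ltW|exact: THM|exact: ltW|exact: QM].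
  - by move=> t; case: (bmeas_state a t bQ).
  - by move=> t w; exact: QM.
(* The means of [Ht] are nondecreasing and converge to the mean of [L] by dominated convergence. *)
have EHL N : \int[P alpha0]_w Ht N w <= \int[P alpha0]_w L w.
  have cE : \int[P alpha0]_w Ht t w @[t --> \oo] --> \int[P alpha0]_w L w.
    apply: (Rintegral_cvg Pa1 (M := M)) => // [t|t w]; last exact: HM.
    by case: (bHt t).
  rewrite -(cvg_lim _ cE)//; apply: nondecreasing_cvgn_le; last first.
    by apply/cvg_ex; eexists; exact: cE.
  apply/nondecreasing_seqP => t; rewrite -subr_ge0 -ED.
  exact: Rintegral_ge0.
(* The lag is now [k.+1], so the exponent [k.-1] of the statement becomes [k]. *)
move=> [//|k] _.
have loss0 t w : 0 <= loss k.+1 t w by rewrite subr_ge0 Uval_le_hval.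
have bU t : bmeas (fun w => Uval u (a t w) (x (t + k.+1)%N w)).
  apply: bmeas_sum => j; apply: bmeasM; first exact: (bmeas_state a t (bmeas_weight R j)).
  exact: (bmeas_action x (t + k.+1) (u j)).
have bh t : bmeas (ht t) := bmeas_state a t (bmeas_hval u).
have bl t : bmeas (loss k.+1 t) := bmeasB (bh t) (bU t).
(* One factor [1 - delta] and [delta ^+ k] come from [lagged_gap]; the other [1 - delta], [lambda]
   and [1 - lambda] come from [drift]. *)
pose c := (1 - lambda) / (lambda * (1 - delta) ^+ 2 * delta ^+ k).
have Eloss t : \int[P alpha0]_w loss k.+1 t w <= c * \int[P alpha0]_w D t w.
  have blag := bmeas_state a t (bmeas_lagged u Pi k.+1).
  (* Inside the mean, the realised payoff is replaced by its conditional mean given the history at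
     [t], for which a pointwise comparison with the drift is available. *)
  have -> : \int[P alpha0]_w loss k.+1 t w =
      \int[P alpha0]_w (ht t w - lagged u Pi k.+1 (a t w)).
    rewrite (bmeas_RintegralB Pa1 measurableT (bh t) (bU t)).
    by rewrite (lagged_mean u Pfollows) -bmeas_RintegralB.
  rewrite -bmeas_RintegralZ//; apply: bmeas_le_Rintegral => //.
  - exact: bmeasB.
  - exact: bmeasZ.
  move=> w; rewrite /D /c mulrAC ler_pdivlMr ?mulr_gt0 ?exprn_gt0//.
  apply: le_trans (drift _).
  have := lagged_gap delta01 Pfollows UM k (a t w).
  rewrite -(ler_pM2l (x := lambda * (1 - delta))) ?mulr_gt0//.
  apply: le_trans; rewrite /ht le_eqVlt; apply/orP; left; apply/eqP; ring.
have sumloss N : \sum_(0 <= t < N) \int[P alpha0]_w loss k.+1 t w <=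
    (1 - lambda) * (fine 'E_(P alpha0)[L] - Hval P a u delta alpha0)
      / (lambda * (1 - delta) ^+ 2 * delta ^+ k.+1.-1).
  apply: (@le_trans _ _ (\sum_(0 <= t < N) c * \int[P alpha0]_w D t w)).
    by apply: ler_sum => t _; exact: Eloss.
  rewrite -big_distrr/= sumED [leRHS]mulrAC -/c ler_pM2l; last first.
    by rewrite divr_gt0// !mulr_gt0 ?exprn_gt0.
  by rewrite lerD2r unlock; exact: EHL.
split=> //.
- exact: integral_series_le.
- exact: ae_cvg_series sumloss.
Qed.
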